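(* Let $Y,Y_1,Y_2,\ldots$ be iid non-degenerate random variables and $\mathbf X_j=(Y_i,i\in G_j)$, $j=1,\ldots,p$, for arbitrary nonempty sets $G_1,\ldots,G_p$ of positive integers of finite size $m_j=|G_j|<\infty$. Let $W=(W_{j,k})_{p\times p}$ be a symmetric matrix with $W_{j,k}\ge0$, and let $\rho^{NL}_{\max,\mathrm{symm}}$ and $\rho^{NL}_{\min,\mathrm{symm}}$ be the extreme symmetric nonlinear correlations among $\mathbf X_1,\ldots,\mathbf X_p$ with weight matrix $W$ (defined in the context). Let $\ell^*=\max_{1\le j\le p}|G_j|$ and, for $1\le\ell\le\ell^*$, let $R^{(\ell)}\in\mathbb R^{p\times p}$ be the matrix with elements $$R^{(\ell)}_{j,k}=\binom{|G_j\cap G_k|}{\ell}\binom{|G_j|}{\ell}^{-1/2}\binom{|G_k|}{\ell}^{-1/2},$$ with the convention $0/0=0$. Let $R=R^{(1)}$ and $J^{(\ell)}=\{1\le j\le p:|G_j|\ge\ell\}$. Then $$\rho^{NL}_{\max,\mathrm{symm}}=\lambda_{\max}(R\circ W),\qquad \rho^{NL}_{\min,\mathrm{symm}}=\min_{1\le\ell\le\ell^*}\lambda_{\min}\Big(\big(R^{(\ell)}\circ W\big)_{J^{(\ell)},J^{(\ell)}}\Big).$$ If in addition there exist sets $G_{0,1},\ldots,G_{0,p}$ of positive integers such that $|G_{0,j}\cap G_{0,k}|=(|G_j\cap G_k|-1)_+$ for all $1\le j<k\le p$ and $|G_{0,j}|\le|G_j|-1$ for all $1\le j\le p$, then $$\rho^{NL}_{\min,\mathrm{symm}}=\lambda_{\min}(R\circ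 W).$$
   Context: A random variable is non-degenerate if its distribution is not concentrated at a single point. $\circ$ is the Schur (entrywise) product; $\lambda_{\max},\lambda_{\min}$ are the largest and smallest eigenvalues of a symmetric matrix; $A_{J,J}$ is the principal submatrix of $A$ indexed by $J$; $x_+=\max(x,0)$; $\binom{m}{\ell}=0$ for $\ell>m$. A function $f(y_1,\ldots,y_m)$ is symmetric if it is invariant under all permutations of its $m$ arguments. Let $\mathcal F_{1:p}$ be the set of all $(f_1,\ldots,f_p)$ with each $f_j(y_1,\ldots,y_{m_j})$ a deterministic symmetric function and $0<\mathrm{Var}(f_j(\mathbf X_j))<\infty$ for all $j$. Put $K_{W,f_{1:p}}=\big(\mathrm{Corr}(f_j(\mathbf X_j),f_k(\mathbf X_k))W_{j,k}\big)_{p\times p}$. The extreme symmetric nonlinear correlations are $$\rho^{NL}_{\max,\mathrm{symm}}=\sup_{f_{1:p}\in\mathcal F_{1:p}}\lambda_{\max}(K_{W,f_{1:p}}),\qquad \rho^{NL}_{\min,\mathrm{symm}}=\inf_{f_{1:p}\in\mathcal F_{1:p}}\lambda_{\min}(K_{W,f_{1:p}}).$$ *)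

(* Defs.v *)
From HB Require Import structures.
From mathcomp Require Import all_boot all_order all_algebra all_fingroup.
From mathcomp Require Import finmap.
From mathcomp Require Import all_classical all_reals all_analysis.

Set Implicit Arguments.
Unset Strict Implicit.
Unset Printing Implicit Defensive.

Import Order.TTheory GRing.Theory Num.Theory.

Local Open Scope classical_set_scope.
Local Open Scope ring_scope.

(* On a symmetric matrix of positive size the set of eigenvalues is finite and
   nonempty, so sup and inf are its maximum and minimum. *)
Definition lambda_max (R : realType) (n : nat) (A : 'M[R]_n) : R :=
  sup [set a | eigenvalue A a].

Definition lambda_min (R : realType) (n : nat) (A : 'M[R]_n) : R :=
  inf [set a | eigenvalue A a].

Definition schur (R : realType) (m n : nat) (A B : 'M[R]_(m, n)) : 'M[R]_(m, n) :=
  map2_mx *%R A B.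

Definition principal_submx (R : realType) (n : nat) (A : 'M[R]_n) (J : {set 'I_n}) :
    'M[R]_#|J| :=
  mxsub (@enum_val _ (mem J)) (@enum_val _ (mem J)) A.

Section Probability.
Context d (T : measurableType d) (R : realType) (P : probability T R).

Definition mutually_independent (I : choiceType) (X : I -> {RV P >-> R}) : Prop :=
  forall (J : {fset I}) (A : I -> set R), (forall i, measurable (A i)) ->
    P (\bigcap_(i in [set` J]) (X i @^-1` A i)) =
      (\prod_(i <- J) P (X i @^-1` A i))%E.

Definition identically_distributed (I : Type) (X : I -> {RV P >-> R}) : Prop :=
  forall (i j : I) (A : set R), measurable A ->
    distribution P (X i) A = distribution P (X j) A.

Definition iid (I : choiceType) (X : I -> {RV P >-> R}) : Prop :=
  mutually_independent X /\ identically_distributed X.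

Definition nondegenerate_rv (X : {RV P >-> R}) : Prop :=
  forall c : R, distribution P X [set c] <> 1%E.

Definition corr (U V : T -> R) : R :=
  fine (covariance P U V) /
    (Num.sqrt (fine 'V_P[U]) * Num.sqrt (fine 'V_P[V])).

(* The vector (Y_i, i in G), listed in the order of the enumeration of G; the
   order is irrelevant to symmetric functions of it. *)
Definition subvector (Y : nat -> {RV P >-> R}) (G : {fset nat}) (w : T) :
    #|` G|.-tuple R :=
  [tuple of map (fun i => Y i w) (in_tuple G)].

Definition symmetric_fun (m : nat) (f : m.-tuple R -> R) : Prop :=
  forall (s : 'S_m) (y : m.-tuple R), f [tuple tnth y (s i) | i < m] = f y.

Variables (p : nat) (Y : nat -> {RV P >-> R}) (G : 'I_p -> {fset nat}).

Definition symm_class : set (forall j : 'I_p, #|` G j|.-tuple R -> R) :=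
  [set f | forall j : 'I_p,
     [/\ measurable_fun [set: #|` G j|.-tuple R] (f j), symmetric_fun (f j),
         (0 < 'V_P[f j \o subvector Y (G j)])%E &
         ('V_P[f j \o subvector Y (G j)] < +oo)%E]].

Definition corr_weighted (W : 'M[R]_p)
    (f : forall j : 'I_p, #|` G j|.-tuple R -> R) : 'M[R]_p :=
  \matrix_(j, k)
    (corr (f j \o subvector Y (G j)) (f k \o subvector Y (G k)) * W j k).

Definition rho_max_symm (W : 'M[R]_p) : \bar R :=
  ereal_sup [set (lambda_max (corr_weighted W f))%:E | f in symm_class].

Definition rho_min_symm (W : 'M[R]_p) : \bar R :=
  ereal_inf [set (lambda_min (corr_weighted W f))%:E | f in symm_class].

End Probability.

(* The convention 0/0 = 0 is that of the field inverse, 0^-1 = 0. *)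
Definition Rmx (R : realType) (p : nat) (G : 'I_p -> {fset nat}) (l : nat) : 'M[R]_p :=
  \matrix_(j, k)
    ('C(#|` G j `&` G k|%fset, l)%:R
      * (Num.sqrt 'C(#|` G j|, l)%:R)^-1 * (Num.sqrt 'C(#|` G k|, l)%:R)^-1).

Definition ell_star (p : nat) (G : 'I_p -> {fset nat}) : nat :=
  \max_(j < p) #|` G j|.

Definition Jset (p : nat) (G : 'I_p -> {fset nat}) (l : nat) : {set 'I_p} :=
  [set j : 'I_p | (l <= #|` G j|)%N]%SET.

(* Main.v *)
Require Import Defs.
From HB Require Import structures.
From mathcomp Require Import all_boot all_order all_algebra all_fingroup.
From mathcomp Require Import finmap.
From mathcomp Require Import all_classical all_reals all_analysis.
From mathcomp Require Import measurable_realfun.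
From mathcomp Require Import ring lra zify.

(* For centered symmetric square-integrable f_1, ..., f_p, the covariance of
   f_j(X_j) and f_k(X_k) is a number c_jk(m) that only depends on
   m = |G_j & G_k|. By Newton's formula c_jk(m) is the sum over l of
   binom(m, l) gamma_jk(l) with gamma_jk(l) = (Delta^l c_jk)(0), and
   gamma_jk(0) = 0 by independence. The matrices (gamma_jk(l))_{j,k} restricted
   to J^(l) are positive semidefinite (they are the Gram matrices of the Hoeffding
   components of order l), so that with D_j = binom(|G_j|, l)^(1/2) / sd_j the
   matrix K_{W,f} is the sum over l of the Schur products of R^(l) o W with
   (D_j D_k gamma_jk(l)), whose diagonals add up to 1. This gives
   K >= min_l lambda_min((R^(l) o W)_{J,J}) and K <= max_l lambda_max(R^(l) o W),
   and R^(l) <= R entrywise reduces the latter maximum to l = 1. The bounds are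
   attained by U-statistics with kernel h(y_1) ... h(y_l), where h is bounded and
   h(Y) is centered and non-degenerate. *)

Set Implicit Arguments.
Unset Strict Implicit.
Unset Printing Implicit Defensive.

Import Order.TTheory GRing.Theory Num.Theory.
Import numFieldNormedType.Exports.

Local Open Scope classical_set_scope.
Local Open Scope ring_scope.

(** * Quadratic forms and extreme eigenvalues *)


(** Three choices shape the argument. The lower bound on quadratic forms is proved for weights of
    either sign, so that the upper bound follows by applying it to [- W]; nonnegativity of [W] then
    lets a test vector be replaced by its absolute value when R^(l) is compared with R. Positivity
    of the Hoeffding matrices is used in dual form: the sum of [A j k * hoeffding j k l] is
    nonnegative for every positive semidefinite [A] supported on J^(l). The Schur product step is
    contained in this pairing, with [A] equal to R^(l) o W minus a multiple of the identity,
    rescaled by D on both sides. The support condition is essential, since c_jk(m) has a meaning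
    only for m up to |G_j| and |G_k|; higher differences are junk, and enter Newton's formula only
    with a zero binomial. Finally, no moment of Y is assumed, which is why the extremal kernel has
    to be bounded. *)

Section QuadraticForms.
Context {R : realType} {n : nat}.
Implicit Types (A B : 'M[R]_n) (u v : 'I_n -> R).

(** Vectors are plain functions, so that rescaled, truncated or absolute-value test vectors can be
    written directly; row vectors appear only for topology and eigenvectors. *)
Definition bform A u v : R := \sum_j \sum_k A j k * (u j * v k).

Definition qform A u : R := bform A u u.

Definition sqn u : R := \sum_j u j ^+ 2.

Definition psd A := forall u, 0 <= qform A u.

Lemma bformC A u v : A^T = A -> bform A u v = bform A v u.
Proof.
move=> As; rewrite /bform exchange_big; apply: eq_bigr => j _.
by apply: eq_bigr => k _; rewrite -[in LHS]As mxE (mulrC (u k)).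
Qed.

Lemma qformN A u : qform (- A) u = - qform A u.
Proof.
rewrite /qform /bform -sumrN; apply: eq_bigr => j _.
by rewrite -sumrN; apply: eq_bigr => k _; rewrite mxE mulNr.
Qed.

Lemma qform_line A u v (t : R) : A^T = A ->
  qform A (fun j => u j + t * v j) =
    qform A u + 2 * t * bform A u v + t ^+ 2 * qform A v.
Proof.
move=> As; have E : 2 * t * bform A u v = t * bform A u v + t * bform A v u.
  by rewrite (bformC v u As); ring.
rewrite E /qform /bform !mulr_sumr -!big_split; apply: eq_bigr => j _.
by rewrite !mulr_sumr -!big_split; apply: eq_bigr => k _ /=; ring.
Qed.

Lemma sqn_ge0 u : 0 <= sqn u.
Proof. by apply: sumr_ge0 => j _; exact: sqr_ge0. Qed.

Lemma sqn_eq0 u : sqn u = 0 -> forall j, u j = 0.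
Proof.
move=> u0 j; have := @psumr_eq0P R _ predT (fun j => u j ^+ 2).
move=> /(_ (fun i _ => sqr_ge0 (u i)) u0 j isT) /eqP.
by rewrite sqrf_eq0 => /eqP.
Qed.

Lemma qform_scale A u (t : R) : qform A (fun j => t * u j) = t ^+ 2 * qform A u.
Proof.
rewrite /qform /bform mulr_sumr; apply: eq_bigr => j _.
by rewrite mulr_sumr; apply: eq_bigr => k _; ring.
Qed.

Lemma sqn_scale u (t : R) : sqn (fun j => t * u j) = t ^+ 2 * sqn u.
Proof. by rewrite /sqn mulr_sumr; apply: eq_bigr => j _; rewrite exprMn. Qed.

Lemma bform_delta A u k : A^T = A ->
  bform A u (fun i => (i == k)%:R) = \sum_j u j * A j k.
Proof.
move=> As; apply: eq_bigr => j _.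
rewrite (bigD1 k)//= eqxx mulr1 big1 ?addr0 1?mulrC// => i /negPf ->.
by rewrite !mulr0.
Qed.

Lemma qform_eigen A (a : R) (v : 'rV[R]_n) :
  v *m A = a *: v -> qform A (v ord0) = a * sqn (v ord0).
Proof.
move=> /rowP vA; rewrite /qform /bform exchange_big /sqn mulr_sumr.
apply: eq_bigr => k _; have := vA k; rewrite !mxE => E.
rewrite expr2 mulrA -E mulr_suml; apply: eq_bigr => j _; ring.
Qed.

Lemma continuous_sum (U : topologicalType) (F : 'I_n -> U -> R) :
  (forall j, continuous (F j)) -> continuous (fun x => \sum_j F j x).
Proof.
move=> cF; apply: (@continuous_big R _ +%R 0 xpredT) => [|j _]; last exact: cF.
exact: add_continuous.
Qed.

Lemma continuous_coordM j k :
  continuous (fun x : 'rV[R]_n => x ord0 j * x ord0 k).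
Proof.
move=> x; apply: (@continuousM R 'rV[R]_n (fun x => x ord0 j)
  (fun x => x ord0 k)); exact: coord_continuous.
Qed.

Lemma continuous_qform A : continuous (fun x : 'rV[R]_n => qform A (x ord0)).
Proof.
apply: (@continuous_sum 'rV[R]_n
  (fun j x => \sum_k A j k * (x ord0 j * x ord0 k))) => j.
apply: (@continuous_sum 'rV[R]_n
  (fun k x => A j k * (x ord0 j * x ord0 k))) => k x.
apply: (@continuousM R 'rV[R]_n (cst (A j k))); first exact: cst_continuous.
exact: continuous_coordM.
Qed.

Lemma continuous_sqn : continuous (fun x : 'rV[R]_n => sqn (x ord0)).
Proof.
apply: (@continuous_sum 'rV[R]_n (fun j x => x ord0 j ^+ 2)) => j.
exact: continuous_coordM.
Qed.

(** The unit sphere is closed and contained in the cube [-1, 1]^n, hence compact, and the form is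
    continuous. *)
Lemma qform_sphere_max A : (0 < n)%N ->
  exists2 u, sqn u = 1 & forall v, sqn v = 1 -> qform A v <= qform A u.
Proof.
move=> n0; pose S := [set v : 'rV[R]_n | sqn (v ord0) = 1].
have Scl : closed S.
  rewrite (_ : S = (fun x : 'rV[R]_n => sqn (x ord0)) @^-1` [set x | x = 1])//.
  apply: preimage_closed; last exact: closed_eq.
  by move=> x _; exact: continuous_sqn.
have Sc : compact S.
  have Sb : S `<=` [set v : 'rV[R]_n | forall i, [set x : R | -1 <= x <= 1] (v ord0 i)].
    move=> v /= Sv i; rewrite /= -ler_norml -(@ler_pXn2r _ 2)//=; last first.
      by rewrite nnegrE.
    rewrite real_normK ?num_real// expr1n -Sv /sqn (bigD1 i)//= lerDl.
    by apply: sumr_ge0 => j _; exact: sqr_ge0.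
  apply: (subclosed_compact Scl _ Sb).
  apply: (@rV_compact R n (fun=> [set x : R | -1 <= x <= 1])) => _.
  by rewrite -set_itvcc; exact: segment_compact.
have S0 : S !=set0.
  exists (\row_i (i == Ordinal n0)%:R).
  rewrite /S /= /sqn (bigD1 (Ordinal n0))//= mxE eqxx expr1n big1 ?addr0//.
  by move=> i /negPf ni; rewrite mxE ni expr0n.
have [u Su umax] := EVT_max_rV S0 Sc
  (continuous_subspaceT (@continuous_qform A)).
exists (u ord0) => [|v v1]; first by move: Su; rewrite inE.
have := umax (\row_i v i); rewrite (_ : (\row_i v i) ord0 = v); last first.
  by apply/funext => i; rewrite mxE.
apply; rewrite inE /S /= -v1; congr sqn; apply/funext => i; by rewrite mxE.
Qed.

Lemma qform_max_eigen A : (0 < n)%N -> A^T = A ->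
  exists2 M : R, eigenvalue A M & forall u, qform A u <= M * sqn u.
Proof.
move=> n0 As; have [u u1 umax] := qform_sphere_max A n0.
pose M := qform A u; have Mmax v : qform A v <= M * sqn v.
  have [v0|] := eqVneq (sqn v) 0.
    rewrite v0 mulr0 /qform /bform big1// => j _; rewrite big1// => k _.
    by rewrite (sqn_eq0 v0) mul0r mulr0.
  rewrite neq_lt ltNge sqn_ge0/= => vp.
  pose t := (Num.sqrt (sqn v))^-1.
  have t2 : t ^+ 2 = (sqn v)^-1 by rewrite exprVn sqr_sqrtr// ltW.
  have := umax (fun j => t * v j); rewrite sqn_scale qform_scale t2.
  rewrite mulVf ?gt_eqF// => /(_ erefl).
  by rewrite mulrC ler_pdivrMr.
exists M => //.
(* The first variation of [M |u|^2 - u A u] vanishes at its minimum. *)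
have lin v : bform A u v = M * (\sum_j u j * v j).
  set b := bform A u v; set s := \sum_j u j * v j.
  have key t : 0 <= 2 * t * (M * s - b) + t ^+ 2 * (M * sqn v - qform A v).
    have := Mmax (fun j => u j + t * v j); rewrite (qform_line _ _ _ As).
    have -> : sqn (fun j => u j + t * v j) = sqn u + 2 * t * s + t ^+ 2 * sqn v.
      rewrite /sqn /s !mulr_sumr -!big_split; apply: eq_bigr => j _ /=; ring.
    rewrite u1 -/M -/b; lra.
  set e := M * s - b in key; set q := M * sqn v - qform A v in key.
  have q0 : 0 <= q by rewrite subr_ge0.
  suff : e = 0 by rewrite /e; lra.
  have q1 : 0 < q + 1 by lra.
  (* The minimizer of [2 * t * e + t ^+ 2 * q] is [- e / q]; the denominator [q + 1] covers [q = 0]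
     and still gives a negative value unless [e = 0]. *)
  have := key (- e / (q + 1)).
  have -> : 2 * (- e / (q + 1)) * e + (- e / (q + 1)) ^+ 2 * q =
            - (e ^+ 2 * (q + 2)) / (q + 1) ^+ 2 by field; rewrite gt_eqF.
  rewrite pmulr_lge0 ?invr_gt0 ?exprn_gt0// oppr_ge0.
  rewrite (pmulr_lle0 (e ^+ 2)); last lra.
  by move=> e2; apply/eqP; rewrite -sqrf_eq0 eq_le e2 sqr_ge0.
apply/eigenvalueP; exists (\row_i u i).
  apply/rowP => k; rewrite !mxE.
  have := lin (fun i => (i == k)%:R); rewrite bform_delta// => E.
  transitivity (\sum_j u j * A j k).
    by apply: eq_bigr => j _; rewrite mxE.
  rewrite E; congr (_ * _); rewrite (bigD1 k)//= eqxx mulr1 big1 ?addr0//.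
  by move=> i /negPf ->; rewrite mulr0.
apply/eqP => /rowP u0; move: u1; rewrite /sqn big1.
  by move/esym/eqP; rewrite oner_eq0.
by move=> j _; have := u0 j; rewrite !mxE => ->; rewrite expr0n.
Qed.

(** The maximal Rayleigh quotient is an eigenvalue and bounds all others, so the [sup] in
    [lambda_max] is attained and is not a default value. *)
Lemma lambda_maxP A : (0 < n)%N -> A^T = A ->
  eigenvalue A (lambda_max A) /\ forall u, qform A u <= lambda_max A * sqn u.
Proof.
move=> n0 As; have [M eM Mmax] := qform_max_eigen n0 As.
suff -> : lambda_max A = M by [].
have ub : ubound [set a | eigenvalue A a] M.
  move=> a /= /eigenvalueP[v va v0].
  have := Mmax (v ord0); rewrite (qform_eigen va) ler_pM2r//.
  rewrite lt_def sqn_ge0 andbT; apply: contra v0 => /eqP /sqn_eq0 v0.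
  by apply/eqP/rowP => i; rewrite mxE v0.
apply/eqP; rewrite eq_le; apply/andP; split.
  by apply: ge_sup => //; exists M.
by apply: ub_le_sup; [exists M|].
Qed.

Lemma lambda_max_ub A u : (0 < n)%N -> A^T = A ->
  qform A u <= lambda_max A * sqn u.
Proof. by move=> n0 As; have [_ ->] := lambda_maxP n0 As. Qed.

Lemma lambda_max_le A (c : R) : (0 < n)%N -> A^T = A ->
  (forall u, qform A u <= c * sqn u) -> lambda_max A <= c.
Proof.
move=> n0 As cmax; have [/eigenvalueP[v va v0] _] := lambda_maxP n0 As.
have := cmax (v ord0); rewrite (qform_eigen va) ler_pM2r//.
rewrite lt_def sqn_ge0 andbT; apply: contra v0 => /eqP /sqn_eq0 v0.
by apply/eqP/rowP => i; rewrite mxE v0.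
Qed.

Lemma lambda_minE A : lambda_min A = - lambda_max (- A).
Proof.
rewrite /lambda_min /lambda_max /inf; congr (- sup _).
apply/seteqP; split => [_ [a /= /eigenvalueP[v va v0] <-]|a].
  by apply/eigenvalueP; exists v => //; rewrite mulmxN va scaleNr.
move=> /= /eigenvalueP[v va v0]; exists (- a); last by rewrite opprK.
by apply/eigenvalueP; exists v => //; rewrite scaleNr -va mulmxN opprK.
Qed.

Lemma lambda_min_lb A u : (0 < n)%N -> A^T = A ->
  lambda_min A * sqn u <= qform A u.
Proof.
move=> n0 As; rewrite lambda_minE mulNr lerNl -qformN lambda_max_ub//.
by rewrite linearN /= As.
Qed.

Lemma le_lambda_min A (c : R) : (0 < n)%N -> A^T = A ->
  (forall u, c * sqn u <= qform A u) -> c <= lambda_min A.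
Proof.
move=> n0 As cmin; rewrite lambda_minE lerNr lambda_max_le//.
  by rewrite linearN /= As.
by move=> u; rewrite qformN mulNr lerN2.
Qed.

End QuadraticForms.

(** * Laws of finite samples *)


Section TupleCylinders.
Context {R : realType} {n : nat}.

Definition cylinder (A : 'I_n -> set R) : set (n.-tuple R) :=
  [set t | forall i, A i (tnth t i)].

Lemma measurable_cylinder (A : 'I_n -> set R) :
  (forall i, measurable (A i)) -> measurable (cylinder A).
Proof.
move=> mA; have -> : cylinder A = \big[setI/setT]_(i < n) ((@tnth n R)^~ i @^-1` A i).
  rewrite -bigcap_seq; apply/seteqP; split => t /= At i; first by move=> _; exact: At.
  by apply: At; rewrite /= mem_index_enum.
apply: bigsetI_measurable => i _; rewrite -[X in measurable X]setTI.
by apply: measurable_tnth => //.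
Qed.

(** Cylinders are closed under intersection, contain the whole space and generate the sigma-algebra
    of tuples. *)
Lemma cylinder_measure_unique (m1 m2 : {measure set (n.-tuple R) -> \bar R}) :
  (m1 setT < +oo)%E ->
  (forall A : 'I_n -> set R, (forall i, measurable (A i)) ->
     m1 (cylinder A) = m2 (cylinder A)) ->
  forall B, measurable B -> m1 B = m2 B.
Proof.
move=> m1oo m12 B mB.
pose G := [set cylinder A | A in [set A : 'I_n -> set R | forall i, measurable (A i)]].
apply: (measure_unique G (fun=> setT)) => //.
- apply/seteqP; split; apply: smallest_sub.
  + exact: smallest_sigma_algebra.
  + rewrite -bigcup_seq => C [i _ [A mA <-]]; apply: sub_sigma_algebra.
    exists (fun j => if j == i then A else setT) => [j /=|]; first by case: ifP.
    apply/seteqP; split => [t /= /(_ i)|t /= [_ At] j]; first by rewrite eqxx.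
    by case: eqP => // ->.
  + exact: sigma_algebra_measurable.
  + by move=> _ [A mA <-]; exact: measurable_cylinder.
- move=> _ _ [A mA <-] [A' mA' <-]; exists (fun i => A i `&` A' i).
    by move=> i; exact: measurableI.
  apply/seteqP; split => t /=; first by move=> At; split => i; case: (At i).
  by move=> [At A't] i; split.
- move=> _; exists (fun=> setT) => //.
  by apply/seteqP; split.
- by rewrite bigcup_const//.
- by move=> _ [A mA <-]; exact: m12.
Qed.

(** Two different measures are allowed because independence will compare [P] restricted to an event
    with a multiple of [P]. *)
Lemma cylinder_preimage_unique d (T : measurableType d) (X X' : T -> n.-tuple R)
    (mu nu : {measure set T -> \bar R}) :
  measurable_fun setT X -> measurable_fun setT X' -> (mu setT < +oo)%E ->
  (forall A : 'I_n -> set R, (forall i, measurable (A i)) ->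
     mu (X @^-1` cylinder A) = nu (X' @^-1` cylinder A)) ->
  forall B, measurable B -> mu (X @^-1` B) = nu (X' @^-1` B).
Proof.
have push (Z : T -> n.-tuple R) (m : {measure set T -> \bar R}) :
    measurable_fun setT Z -> exists mZ : {measure set (n.-tuple R) -> \bar R},
      forall B, mZ B = m (Z @^-1` B).
  by move=> mZ; unshelve eexists (pushforward m Z).
move=> mX mX' muoo muA B mB.
have [m1 m1E] := push _ mu mX; have [m2 m2E] := push _ nu mX'.
rewrite -m1E -m2E; apply: cylinder_measure_unique mB.
  by rewrite m1E preimage_setT.
by move=> A mA; rewrite m1E m2E muA.
Qed.

End TupleCylinders.

(** * Means of square-integrable random variables *)

Section Probability.
Context d (T : measurableType d) (R : realType) (P : probability T R).

Definition mean (X : T -> R) : R := \int[P]_x X x.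

Lemma Lfun2P (X : T -> R) : X \in Lfun P 2%:E <->
  measurable_fun setT X /\ (\int[P]_x ((X x) ^+ 2)%:E < +oo)%E.
Proof.
split=> [X2|[mX X2]].
  split; first by move: X2 => /sub_Lfun_mfun; rewrite inE.
  exact: (integrable_lty _ (Lfun2_integrable_sqr X2)).
apply/andP; split; rewrite inE//= /finite_norm unlock.
apply: poweR_lty; apply: le_lt_trans X2.
rewrite le_eqVlt; apply/orP; left; apply/eqP; apply: eq_integral => x _.
by rewrite -[LHS]/((`|X x| `^ 2%:R)%:E) powR_mulrn// real_normK ?num_real.
Qed.

Lemma Lfun2_measurable (X : T -> R) : X \in Lfun P 2%:E -> measurable_fun setT X.
Proof. by move=> /Lfun2P[]. Qed.

Lemma Lfun2_mulL1 (X Z : T -> R) : X \in Lfun P 2%:E -> Z \in Lfun P 2%:E ->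
  P.-integrable setT (EFin \o (fun w => X w * Z w)).
Proof. by move=> X2 Z2; apply/Lfun1_integrable; exact: Lfun2_mul_Lfun1. Qed.

Lemma Lfun2_integrable (X : T -> R) : X \in Lfun P 2%:E ->
  P.-integrable setT (EFin \o X).
Proof.
move=> X2; apply/Lfun1_integrable; apply: Lfun_subset12 => //.
exact: fin_num_measure.
Qed.

Lemma mean_sum (I : eqType) (r : seq I) (c : I -> R) (X : I -> T -> R) :
  {in r, forall i, P.-integrable setT (EFin \o X i)} ->
  mean (fun w => \sum_(i <- r) c i * X i w) = \sum_(i <- r) c i * mean (X i).
Proof.
elim: r => [_|i r IH iX].
  rewrite big_nil /mean; under eq_Rintegral do rewrite big_nil.
  by rewrite Rintegral_cst// mul0r.
have iXr : {in r, forall i, P.-integrable setT (EFin \o X i)}.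
  by move=> j jr; apply: iX; rewrite inE jr orbT.
have iXi := iX i (mem_head _ _).
rewrite big_cons -(IH iXr) /mean -RintegralZl// -RintegralD//.
- by apply: eq_Rintegral => w _; rewrite big_cons.
- by apply: (integrableZl _ _ iXi).
- rewrite (_ : _ \o _ = fun w => (\sum_(i <- r | i \in r) (c i)%:E * (X i w)%:E)%E).
    apply: integrable_sum => // j jr; exact: (integrableZl _ _ (iXr j jr)).
  by apply/funext => w /=; rewrite -big_seq sumEFin.
Qed.

Lemma Lfun2_sum (I : eqType) (r : seq I) (c : I -> R) (X : I -> T -> R) :
  {in r, forall i, X i \in Lfun P 2%:E} ->
  (fun w => \sum_(i <- r) c i * X i w) \in Lfun P 2%:E.
Proof.
elim: r => [_|i r IH X2].
  rewrite (_ : (fun _ => _) = cst 0); first exact: Lfun_cst.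
  by apply/funext => w; rewrite big_nil.
have X2r : {in r, forall i, X i \in Lfun P 2%:E}.
  by move=> j jr; apply: X2; rewrite inE jr orbT.
rewrite (_ : (fun _ => _) = (c i \o* X i) \+ fun w => \sum_(i <- r) c i * X i w).
  have l12 : (1 <= 2%:E :> \bar R)%E by rewrite lee_fin ler1n.
  have [_ ->//] := Lfun_addr_closed P l12; last exact: IH.
  by apply: Lfun_scale; [rewrite ler1n|apply: X2; exact: mem_head].
by apply/funext => w; rewrite big_cons /= mulrC.
Qed.

Lemma mean_bilinear (I J : eqType) (r : seq I) (r' : seq J) (a : I -> R)
    (b : J -> R) (X : I -> T -> R) (Z : J -> T -> R) :
  {in r, forall i, X i \in Lfun P 2%:E} ->
  {in r', forall j, Z j \in Lfun P 2%:E} ->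
  mean (fun w => (\sum_(i <- r) a i * X i w) * (\sum_(j <- r') b j * Z j w)) =
  \sum_(i <- r) \sum_(j <- r') a i * b j * mean (fun w => X i w * Z j w).
Proof.
move=> X2 Z2; pose S w := \sum_(j <- r') b j * Z j w.
have S2 : S \in Lfun P 2%:E by exact: Lfun2_sum.
transitivity (mean (fun w => \sum_(i <- r) a i * (X i w * S w))).
  congr mean; apply/funext => w; rewrite mulr_suml; apply: eq_bigr => i _.
  by rewrite mulrA.
rewrite mean_sum => [|i ir]; last exact: Lfun2_mulL1 (X2 i ir) S2.
apply: eq_big_seq => i ir.
transitivity (a i * mean (fun w => \sum_(j <- r') b j * (X i w * Z j w))).
  congr (_ * mean _); apply/funext => w; rewrite mulr_sumr.
  by apply: eq_bigr => j _; ring.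
rewrite mean_sum => [|j jr]; last exact: Lfun2_mulL1 (X2 i ir) (Z2 j jr).
by rewrite mulr_sumr; apply: eq_bigr => j _; rewrite mulrA.
Qed.

Lemma mean_cst (c : R) : mean (cst c) = c.
Proof. by have := congr1 fine (expectation_cst P c); rewrite unlock. Qed.

(** The quadratic form of [A] is nonnegative at each sample point, and so is its integral. *)
Lemma mean_psd (p : nat) (A : 'M[R]_p) (X : 'I_p -> T -> R) :
  psd A -> (forall j, X j \in Lfun P 2%:E) ->
  0 <= \sum_j \sum_k A j k * mean (fun w => X j w * X k w).
Proof.
move=> A0 X2; rewrite pair_bigA/=.
rewrite -(@mean_sum _ _ (fun i : 'I_p * 'I_p => A i.1 i.2)
                     (fun i w => X i.1 w * X i.2 w)).
  apply: Rintegral_ge0 => w _.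
  by rewrite -(pair_bigA _ (fun i j => A i j * (X i w * X j w)))/=; exact: A0.
by move=> i _; exact: Lfun2_mulL1.
Qed.

(** The joint law is the product of the marginals, so Fubini applies; integrability on the product
    space is transported from that of [X w * Z w]. *)
Lemma mean_mul_indep (X Z : T -> R) :
  X \in Lfun P 2%:E -> Z \in Lfun P 2%:E ->
  (forall A B, measurable A -> measurable B ->
     P (X @^-1` A `&` Z @^-1` B) = (P (X @^-1` A) * P (Z @^-1` B))%E) ->
  mean (fun w => X w * Z w) = mean X * mean Z.
Proof.
move=> X2 Z2 XZ.
have mX := Lfun2_measurable X2; have mZ := Lfun2_measurable Z2.
pose XZf w := (X w, Z w).
have mXZ : measurable_fun setT XZf by exact/measurable_fun_pairP.
pose X_ : {mfun T >-> R} := HB.pack X (isMeasurableFun.Build _ _ _ _ _ mX).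
pose Z_ : {mfun T >-> R} := HB.pack Z (isMeasurableFun.Build _ _ _ _ _ mZ).
pose mu := distribution P X_; pose nu := distribution P Z_.
pose g (z : R * R) : R := z.1 * z.2; pose f : R * R -> \bar R := EFin \o g.
have mg : measurable_fun [set: R * R] g by apply: measurable_funM.
have mf : measurable_fun [set: R * R] f.
  exact/measurable_EFinP.
have i12 : P.-integrable setT (f \o XZf) by exact: Lfun2_mulL1.
have law B : measurable B -> (mu \x nu)%E B = pushforward P XZf B.
  move=> mB; apply: (product_measure_unique (m1:=mu) (m2:=nu)) mB => A C mA mC.
  by rewrite -XZ.
have E1 : (\int[P]_w (X w * Z w)%:E = \int[mu \x nu]_z f z)%E.
  rewrite -[LHS](integral_pushforward mXZ mf i12 measurableT).
  apply: eq_measure_integral => A mA _; exact/esym/law.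
have if12 : (mu \x nu)%E.-integrable setT f.
  apply/integrableP; split => //.
  rewrite (@eq_measure_integral _ _ _ _ (pushforward P XZf)); last first.
    by move=> A mA _; exact: law.
  rewrite ge0_integral_pushforward//; last exact: measurableT_comp.
  by have /integrableP[] := i12.
have iX_ : P.-integrable setT (EFin \o X) by exact: Lfun2_integrable.
have iZ : P.-integrable setT (EFin \o Z) by exact: Lfun2_integrable.
have Efin (V : T -> R) (mV : measurable_fun setT V) : P.-integrable setT (EFin \o V) ->
    (\int[pushforward P V]_x x%:E)%E = (mean V)%:E /\
    (pushforward P V).-integrable setT EFin.
  move=> iV; split; last exact: (@integrable_pushforward _ _ _ _ _ V).
  rewrite integral_pushforward//.
  by rewrite /mean /Rintegral fineK//; exact: integrable_fin_num.
have [EX iX] := Efin _ mX iX_; have [EZ iZ'] := Efin _ mZ iZ.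
rewrite {1}/mean /Rintegral E1 -integral12_prod_meas1//.
rewrite (_ : fubini_F _ _ = fun x : R => (x%:E * (mean Z)%:E)%E).
  by rewrite integralZr// EX.
apply/funext => x; rewrite /fubini_F /f /=.
under eq_integral do rewrite EFinM.
by rewrite integralZl// EZ.
Qed.

End Probability.

(** * Laws of samples with distinct indices *)

Section Sample.
Context d (T : measurableType d) (R : realType) (P : probability T R).
Variable Y : nat -> {RV P >-> R}.
Hypothesis Yiid : iid Y.

Definition tsample n (s : n.-tuple nat) (w : T) : n.-tuple R :=
  [tuple of map (fun i => Y i w) s].

Lemma measurable_tsample n (s : n.-tuple nat) : measurable_fun setT (tsample s).
Proof.
apply/measurable_fun_tnthP => i.
rewrite (_ : _ \o _ = Y (tnth s i)); first exact: measurable_funP.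
by apply/funext => w /=; rewrite tnth_map.
Qed.

Lemma law_cylinder n (s : n.-tuple nat) (A : 'I_n -> set R) :
  uniq s -> (forall i, measurable (A i)) ->
  P (tsample s @^-1` cylinder A) = (\prod_(i < n) P (Y 0 @^-1` A i))%E.
Proof.
move=> us mA; have [Yind Yid] := Yiid.
(* The sets are moved from positions in [s] to indices of [Y]; [uniq s] makes this consistent, and
   indices outside [s] are unconstrained. *)
pose A' j := if insub (index j s) is Some i then A i else setT.
have A'E i : A' (tnth s i) = A i.
  rewrite /A' (tnth_nth 0%N) index_uniq ?size_tuple// insubT//= => lt_in.
  by congr A; apply: val_inj.
have mA' j : measurable (A' j) by rewrite /A'; case: insub.
pose J := [fset j in (s : seq nat)]%fset.
have := Yind J A' mA'.
have -> : \bigcap_(i in [set` J]) (Y i @^-1` A' i) = tsample s @^-1` cylinder A.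
  apply/seteqP; split => [w /= Yw i|w /= Yw j /=].
    rewrite tnth_map -A'E; apply: Yw.
    by rewrite /= /J !inE/= mem_tnth.
  rewrite /J !inE => /tnthP[i ->]; have := Yw i.
  by rewrite tnth_map -A'E.
move=> ->.
have pJ : perm_eq J s.
  apply: uniq_perm => // j; by rewrite /J !inE.
rewrite (perm_big _ pJ)/= big_tuple; apply: eq_bigr => i _.
by rewrite A'E; exact: Yid.
Qed.

Lemma law_tsample n (s s' : n.-tuple nat) (B : set (n.-tuple R)) :
  uniq s -> uniq s' -> measurable B ->
  P (tsample s @^-1` B) = P (tsample s' @^-1` B).
Proof.
move=> us us' mB.
apply: (cylinder_preimage_unique (mu := P) (nu := P)
  (measurable_tsample s) (measurable_tsample s')) mB.
  by rewrite -ge0_fin_numE// fin_num_measure.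
by move=> A mA; have := law_cylinder us mA; rewrite -(law_cylinder us' mA).
Qed.

(* The pi-lambda argument is applied to one factor at a time, for a fixed event
   [D] determined by the other one. *)
Lemma indep_tsample m n (s : m.-tuple nat) (s' : n.-tuple nat) A B :
  uniq (s ++ s') -> measurable A -> measurable B ->
  P (tsample s @^-1` A `&` tsample s' @^-1` B) =
  (P (tsample s @^-1` A) * P (tsample s' @^-1` B))%E.
Proof.
move=> uss; have [us us'] : uniq s /\ uniq s'.
  by move: uss; rewrite cat_uniq => /and3P[].
have mpre k (r : k.-tuple nat) C : measurable C -> measurable (tsample r @^-1` C).
  by move=> mC; rewrite -[X in measurable X]setTI; exact: measurable_tsample.
have step k (r : k.-tuple nat) (D : set T) (mD : measurable D) :
    (forall C, (forall i, measurable (C i)) ->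
      P (tsample r @^-1` cylinder C `&` D) =
      (P (tsample r @^-1` cylinder C) * P D)%E) ->
    forall C, measurable C -> P (tsample r @^-1` C `&` D) =
      (P (tsample r @^-1` C) * P D)%E.
  move=> cyl C mC; pose c : {nonneg R} := NngNum (fine_ge0 (measure_ge0 P D)).
  have cE : (c%:num%:E = P D)%E by rewrite /c/= fineK// fin_num_measure.
  transitivity (mscale c P (tsample r @^-1` C)); last first.
    by rewrite /mscale cE muleC.
  apply: (cylinder_preimage_unique (mu := mrestr P mD) (nu := mscale c P)
    (measurable_tsample r) (measurable_tsample r)) mC.
    by rewrite /= /mrestr setTI -ge0_fin_numE// fin_num_measure.
  by move=> E mE; have := cyl _ mE; rewrite muleC -cE.
move=> mA mB; apply: (step _ _ _ (mpre _ _ _ mB)) mA => C mC.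
have mcC := measurable_cylinder mC.
rewrite setIC muleC; apply: (step _ _ _ (mpre _ _ _ mcC)) mB => E mE.
have us's : uniq [tuple of s' ++ s] by rewrite /= uniq_catC.
(* The two cylinders are glued into one over [s' ++ s], in this order because the factors have just
   been exchanged. *)
pose CE (i : 'I_(n + m)) := match fintype.split i with inl j => E j | inr j => C j end.
have mCE i : measurable (CE i) by rewrite /CE; case: fintype.split.
have := law_cylinder us's mCE.
rewrite big_split_ord/= => H.
rewrite !law_cylinder//.
transitivity (P (tsample [tuple of s' ++ s] @^-1` cylinder CE)).
  congr (P _); apply/seteqP; split => [w /= [Ew Cw] i|w /= H'].
    rewrite /CE; case: (split_ordP i) => j -> .
      have := Ew j; rewrite !tnth_map/= !(tnth_nth 0%N)/= nth_cat size_tuple.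
      by rewrite ltn_ord.
    have := Cw j; rewrite !tnth_map/= !(tnth_nth 0%N)/= nth_cat size_tuple.
    by rewrite ltnNge leq_addr/= addKn.
  split => j.
    have := H' (lshift m j); rewrite /CE !tnth_map/= !(tnth_nth 0%N)/= nth_cat.
    by rewrite size_tuple ltn_ord (unsplitK (inl j)).
  have := H' (rshift n j); rewrite /CE !tnth_map/= !(tnth_nth 0%N)/= nth_cat size_tuple.
  by rewrite ltnNge leq_addr/= addKn (unsplitK (inr j)).
rewrite H; congr (_ * _)%E; apply: eq_bigr => j _.
  by rewrite /CE (unsplitK (inl j)).
by rewrite /CE (unsplitK (inr j)).
Qed.

End Sample.


(** * Functions of sequences, and moments of overlapping samples *)

Section SeqMeasurable.
Context {R : realType}.
Implicit Types F G : seq R -> R.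

(** Functions of sequences of any length give samples of different sizes a common type;
    measurability is then required length by length. *)
Definition seq_measurable F :=
  forall n, measurable_fun [set: n.-tuple R] (fun t : n.-tuple R => F t).

Definition seq_symmetric F := forall s s', perm_eq s s' -> F s = F s'.

Lemma seq_measurable_comp d (T : measurableType d) F n (phi : T -> seq R) :
  seq_measurable F -> (forall t, size (phi t) = n) ->
  (forall i, measurable_fun setT (fun t => nth 0 (phi t) i)) ->
  measurable_fun setT (fun t => F (phi t)).
Proof.
move=> mF szphi mphi; have szb t : size (phi t) == n by apply/eqP.
apply: (measurableT_comp (mF n) (g := fun t => Tuple (szb t))).
apply/measurable_fun_tnthP => i.
rewrite (_ : _ \o _ = fun t => nth 0 (phi t) i)//.
by apply/funext => t /=; rewrite (tnth_nth 0).
Qed.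

Lemma measurable_nth n i : measurable_fun [set: n.-tuple R] (fun t => nth 0 t i).
Proof.
have [lt_in|le_ni] := ltnP i n.
  rewrite (_ : (fun _ => _) = (@tnth n R)^~ (Ordinal lt_in)).
    exact: measurable_tnth.
  by apply/funext => t; rewrite (tnth_nth 0).
rewrite (_ : (fun _ => _) = cst 0); first exact: measurable_cst.
by apply/funext => t; rewrite nth_default ?size_tuple.
Qed.

End SeqMeasurable.

Section Sample.
Context d (T : measurableType d) (R : realType) (P : probability T R).
Variable Y : nat -> {RV P >-> R}.
Implicit Types (F G : seq R -> R) (A B s : seq nat).

Definition sample s (w : T) : seq R := [seq Y i w | i <- s].

Lemma measurable_sample F s : seq_measurable F ->
  measurable_fun setT (F \o sample s).
Proof.
move=> mF; apply: (seq_measurable_comp mF (n := size s)) => [w|i].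
  by rewrite size_map.
have [lt_is|le_si] := ltnP i (size s).
  rewrite (_ : (fun _ => _) = Y (nth 0%N s i)); first exact: measurable_funP.
  by apply/funext => w; rewrite (nth_map 0%N).
rewrite (_ : (fun _ => _) = cst 0); first exact: measurable_cst.
by apply/funext => w; rewrite nth_default ?size_map.
Qed.

Hypothesis Yiid : iid Y.

Lemma ge0_integral_tsample n (s s' : n.-tuple nat) (H : n.-tuple R -> \bar R) :
  uniq s -> uniq s' -> measurable_fun setT H -> (forall t, 0 <= H t)%E ->
  (\int[P]_w H (tsample Y s w) = \int[P]_w H (tsample Y s' w))%E.
Proof.
move=> us us' mH H0.
have H0' : {in [set: n.-tuple R], forall t, 0 <= H t}%E by move=> t _; exact: H0.
have E (r : n.-tuple nat) :=
  ge0_integral_pushforward (measurable_tsample Y r) P measurableT mH H0'.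
apply: (etrans (esym (E s))); apply: (etrans _ (E s')).
by apply: eq_measure_integral => [||? ? C mC _];
  [exact: measurable_tsample..|exact: law_tsample].
Qed.

Lemma integrable_tsample n (s s' : n.-tuple nat) (H : n.-tuple R -> R) :
  uniq s -> uniq s' -> measurable_fun setT H ->
  P.-integrable setT (EFin \o H \o tsample Y s) ->
  P.-integrable setT (EFin \o H \o tsample Y s').
Proof.
move=> us us' mH /integrableP[_ iH]; apply/integrableP; split.
  by apply/measurable_EFinP; exact: (measurableT_comp mH (measurable_tsample Y s')).
apply: le_lt_trans iH.
rewrite (@ge0_integral_tsample _ s s' (fun t => `|(H t)%:E|%E))//.
by apply: measurableT_comp => //; exact/measurable_EFinP.
Qed.

Lemma mean_tsample n (s s' : n.-tuple nat) (H : n.-tuple R -> R) :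
  uniq s -> uniq s' -> measurable_fun setT H ->
  P.-integrable setT (EFin \o H \o tsample Y s) ->
  mean P (H \o tsample Y s) = mean P (H \o tsample Y s').
Proof.
move=> us us' mH iH; have iH' := integrable_tsample us us' mH iH.
have mH' : measurable_fun setT (EFin \o H) by exact/measurable_EFinP.
rewrite /mean /Rintegral; congr fine.
have E r iHr :=
  @integral_pushforward _ _ _ _ _ _ (measurable_tsample Y r) P setT _ mH' iHr
    measurableT.
apply: (etrans (esym (E s iH))); apply: (etrans _ (E s' iH')).
by apply: eq_measure_integral => [||? ? C mC _];
  [exact: measurable_tsample..|exact: law_tsample].
Qed.

Lemma Lfun2_sample F s s' : seq_measurable F -> uniq s -> uniq s' ->
  size s = size s' -> F \o sample s \in Lfun P 2%:E ->
  F \o sample s' \in Lfun P 2%:E.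
Proof.
move=> mF us us' ss' /Lfun2P[_ F2]; apply/Lfun2P; split.
  exact: measurable_sample.
apply: le_lt_trans F2; have szs : size s == size s' by exact/eqP.
pose H (t : (size s').-tuple R) : \bar R := (F t ^+ 2)%:E.
rewrite (@ge0_integral_tsample _ (Tuple szs) (in_tuple s') H)//.
  by apply/measurable_EFinP; apply: measurable_funX; exact: mF.
by move=> t; rewrite lee_fin sqr_ge0.
Qed.

Lemma mean_sample F s s' : seq_measurable F -> uniq s -> uniq s' ->
  size s = size s' -> F \o sample s \in Lfun P 2%:E ->
  mean P (F \o sample s) = mean P (F \o sample s').
Proof.
move=> mF us us' ss' F2; have szs : size s == size s' by exact/eqP.
pose H (t : (size s').-tuple R) : R := F t.
apply: (@mean_tsample _ (Tuple szs) (in_tuple s') H) => //.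
exact: Lfun2_integrable F2.
Qed.

Lemma sample_indep F G A B : seq_measurable F -> seq_measurable G ->
  uniq (A ++ B) -> F \o sample A \in Lfun P 2%:E ->
  G \o sample B \in Lfun P 2%:E ->
  mean P (fun w => F (sample A w) * G (sample B w)) =
  mean P (F \o sample A) * mean P (G \o sample B).
Proof.
move=> mF mG uAB FA GB; apply: mean_mul_indep => // C D mC mD.
have := @indep_tsample _ _ _ _ _ Yiid _ _ (in_tuple A) (in_tuple B)
  ((fun t : (size A).-tuple R => F t) @^-1` C)
  ((fun t : (size B).-tuple R => G t) @^-1` D) uAB; apply.
  by rewrite -[X in measurable X]setTI; exact: mF.
by rewrite -[X in measurable X]setTI; exact: mG.
Qed.

(** List the union of [A] and [B] as common part, rest of [A], rest of [B]. By symmetry of [F] and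
    [G] the product is a fixed function of this sample with distinct indices, whose law depends on
    its length only. *)
Lemma sample_cross F G A B A' B' :
  seq_measurable F -> seq_measurable G -> seq_symmetric F -> seq_symmetric G ->
  uniq A -> uniq B -> uniq A' -> uniq B' ->
  size A = size A' -> size B = size B' ->
  count (mem B) A = count (mem B') A' ->
  F \o sample A \in Lfun P 2%:E -> G \o sample B \in Lfun P 2%:E ->
  mean P (fun w => F (sample A w) * G (sample B w)) =
  mean P (fun w => F (sample A' w) * G (sample B' w)).
Proof.
move=> mF mG sF sG uA uB uA' uB' AA' BB' cAB FA GB.
pose i := count (mem B) A; pose a := size A; pose b := size B.
(* In the listing [cc] below, [F] reads the first [a] entries; [G] reads the [i] common ones and
   everything after position [a]. *)
pose H n (t : n.-tuple R) := F (take a t) * G (take i t ++ drop a t).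
pose cc (A B : seq nat) := [seq x <- A | x \in B] ++ [seq x <- A | x \notin B]
  ++ [seq x <- B | x \notin A].
have szcc A0 B0 : uniq A0 -> uniq B0 ->
    size (cc A0 B0) = (size A0 + (size B0 - count (mem B0) A0))%N.
  move=> u0 v0; rewrite /cc catA size_cat (perm_size (permEl (perm_filterC _ _))).
  congr (_ + _)%N; rewrite size_filter.
  have -> : count (mem B0) A0 = count (mem A0) B0.
    rewrite -!size_filter; apply: perm_size; apply: uniq_perm.
    - exact: filter_uniq.
    - exact: filter_uniq.
    - by move=> x; rewrite !mem_filter andbC.
  by rewrite -(count_predC (mem A0) B0) addKn.
have ucc A0 B0 : uniq A0 -> uniq B0 -> uniq (cc A0 B0).
  move=> u0 v0; rewrite /cc catA cat_uniq.
  rewrite (perm_uniq (permEl (perm_filterC _ _))) u0 filter_uniq// andbT/=.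
  apply/hasPn => x; rewrite mem_filter => /andP[xA _].
  by rewrite /= (perm_mem (permEl (perm_filterC _ _))).
have HE A0 B0 w : uniq A0 -> uniq B0 -> size A0 = a -> count (mem B0) A0 = i ->
    F (take a (sample (cc A0 B0) w)) *
      G (take i (sample (cc A0 B0) w) ++ drop a (sample (cc A0 B0) w)) =
    F (sample A0 w) * G (sample B0 w).
  move=> u0 v0 A0a ci; rewrite /sample -!map_take -map_drop -map_cat.
  have -> : take a (cc A0 B0) = [seq x <- A0 | x \in B0] ++ [seq x <- A0 | x \notin B0].
    rewrite /cc catA take_size_cat//.
    by rewrite (perm_size (permEl (perm_filterC _ _))).
  have -> : drop a (cc A0 B0) = [seq x <- B0 | x \notin A0].
    rewrite /cc catA drop_size_cat//.
    by rewrite (perm_size (permEl (perm_filterC _ _))).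
  have -> : take i (cc A0 B0) = [seq x <- A0 | x \in B0].
    by rewrite /cc take_size_cat// size_filter.
  congr (_ * _); [apply: sF|apply: sG]; apply: perm_map.
    exact/permEl/perm_filterC.
  apply: uniq_perm => //.
    rewrite cat_uniq !filter_uniq// andbT/=; apply/hasPn => x.
    by rewrite !mem_filter => /andP[/negPf xA _]; rewrite /= xA andbF.
  by move=> x; rewrite mem_cat !mem_filter; case: (x \in A0); case: (x \in B0).
have mH n : measurable_fun [set: n.-tuple R] (@H n).
  apply: measurable_funM.
    apply: (seq_measurable_comp mF (n := minn a n)) => [t|k].
      by rewrite size_take_min size_tuple.
    have [lt_ka|le_ak] := ltnP k a.
      by under eq_fun do rewrite nth_take//; exact: measurable_nth.
    rewrite (_ : (fun _ => _) = cst 0); first exact: measurable_cst.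
    by apply/funext => t; rewrite nth_default// size_take_min geq_min le_ak.
  apply: (seq_measurable_comp mG (n := (minn i n + (n - a))%N)) => [t|k].
    by rewrite size_cat size_take_min size_drop size_tuple.
  under eq_fun do rewrite nth_cat size_take_min size_tuple nth_drop.
  case: ltnP => [|_]; last exact: measurable_nth.
  rewrite leq_min => /andP[ki _].
  by under eq_fun do rewrite nth_take//; exact: measurable_nth.
have sz : size (cc A B) == size (cc A' B').
  by rewrite !szcc// AA' BB' cAB.
have E1 : (fun w => F (sample A w) * G (sample B w)) = @H _ \o tsample Y (Tuple sz).
  by apply/funext => w; rewrite -(HE A B).
have E2 : (fun w => F (sample A' w) * G (sample B' w)) =
    @H _ \o tsample Y (in_tuple (cc A' B')).
  by apply/funext => w; rewrite -(HE A' B') -?AA'.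
rewrite E1 E2; apply: mean_tsample => //.
- exact: ucc.
- exact: ucc.
- rewrite -compA -E1; exact: Lfun2_mulL1 FA GB.
Qed.

End Sample.

(** * Finite differences and Hoeffding components *)


Section FiniteDifferences.
Context {R : realType}.
Implicit Types c : nat -> R.

Definition fdiff c : nat -> R := fun m => c m.+1 - c m.

(** Pascal's rule and induction on [m]. Terms with [l > m] vanish, so one common upper limit [n]
    serves all overlaps. *)
Lemma newton_forward c m n : (m <= n)%N ->
  c m = \sum_(l < n.+1) 'C(m, l)%:R * iter l fdiff c 0%N.
Proof.
elim: m n c => [|m IH] n c lmn.
  rewrite big_ord_recl /= bin0 mul1r big1 ?addr0// => i _.
  by rewrite bin0n mul0r.
case: n lmn => // n lmn.
have -> : c m.+1 = c m + fdiff c m by rewrite /fdiff; ring.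
rewrite (IH n.+1)//; last exact: ltnW.
rewrite [in X in _ + X](IH n)// big_ord_recl [RHS]big_ord_recl /= !bin0 -addrA.
congr (_ + _); rewrite -big_split; apply: eq_bigr => i _ /=.
by rewrite /bump /= add1n binS natrD mulrDl -iterS -iterSr.
Qed.

(* The vertices of the [l]-cube: a vertex selects one of the indices [2i], [2i+1]
   for each [i < l], and carries the sign of the number of odd indices. *)
Fixpoint cube l : seq (R * seq nat) :=
  if l is l'.+1 then
    [seq (x.1, l'.*2 :: x.2) | x <- cube l'] ++
    [seq (- x.1, l'.*2.+1 :: x.2) | x <- cube l']
  else [:: (1, [::])].

Lemma cube_spec l x : x \in cube l ->
  [/\ size x.2 = l, uniq x.2 & all (fun i => i < l.*2)%N x.2].
Proof.
elim: l x => [|l IH] x /=; first by rewrite inE => /eqP ->.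
rewrite mem_cat => /orP[] /mapP[y /IH[sy uy ay] ->] /=; split.
- by rewrite sy.
- by rewrite uy andbT; apply/negP => /(allP ay); rewrite ltnn.
- rewrite doubleS !ltnS leqnSn /=; apply: sub_all ay => i; lia.
- by rewrite sy.
- by rewrite uy andbT; apply/negP => /(allP ay) /=; lia.
- rewrite doubleS !ltnS leqnn /=; apply: sub_all ay => i; lia.
Qed.

(** In each of the [l] directions, two equal choices raise the overlap by one and carry sign +, two
    different choices leave it unchanged and carry sign -. With two pairs of each kind, every
    direction contributes twice a forward difference. *)
Lemma cube_sum l c :
  \sum_(x <- cube l) \sum_(y <- cube l) x.1 * y.1 * c (count (mem y.2) x.2) =
  2 ^+ l * iter l fdiff c 0%N.
Proof.
elim: l c => [|l IH] c; first by rewrite !big_seq1 /= !mul1r.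
have notin a x : x \in cube l -> (l.*2 <= a)%N -> (a \in x.2) = false.
  move=> /cube_spec[_ _ /allP ax] la; apply/negP => /ax; lia.
have cnt a b x y : x \in cube l -> y \in cube l -> (l.*2 <= a)%N -> (l.*2 <= b)%N ->
    count (mem (b :: y.2)) (a :: x.2) = ((a == b) + count (mem y.2) x.2)%N.
  move=> xl yl la lb; rewrite /= inE notin// orbF; congr (_ + _)%N.
  apply: eq_in_count => i ix /=; rewrite inE; case: eqP => // ib.
  by move: ix; rewrite ib notin.
have E a b : (l.*2 <= a)%N -> (l.*2 <= b)%N ->
    \sum_(x <- cube l) \sum_(y <- cube l)
      x.1 * y.1 * c (count (mem (b :: y.2)) (a :: x.2)) =
    2 ^+ l * iter l fdiff (fun m => c ((a == b) + m)%N) 0%N.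
  move=> la lb; rewrite -IH; apply: eq_big_seq => x xl; apply: eq_big_seq => y yl.
  by rewrite cnt.
pose s2 a b := \sum_(x <- cube l) \sum_(y <- cube l)
  x.1 * y.1 * c (count (mem (b :: y.2)) (a :: x.2)).
have -> : \sum_(x <- cube l.+1) \sum_(y <- cube l.+1)
      x.1 * y.1 * c (count (mem y.2) x.2) =
    s2 l.*2 l.*2 - s2 l.*2 l.*2.+1 - s2 l.*2.+1 l.*2 + s2 l.*2.+1 l.*2.+1.
  rewrite [cube l.+1]/= big_cat !big_map /s2 -!sumrN -!big_split /= -big_split /=.
  apply: eq_bigr => x _; rewrite !big_cat !big_map /= -!sumrN -!big_split /=.
  by apply: eq_bigr => y _; ring.
have iter_fdiffB (f g : nat -> R) : iter l fdiff (fun m => f m - g m) 0%N =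
    iter l fdiff f 0%N - iter l fdiff g 0%N.
  suff H k m : iter k fdiff (fun m => f m - g m) m =
    iter k fdiff f m - iter k fdiff g m by exact: H.
  by elim: k m => //= k IHk m; rewrite /fdiff !IHk; ring.
rewrite /s2 !E ?leqnSn// !eqxx (gtn_eqF (ltnSn _)) (ltn_eqF (ltnSn _)).
rewrite exprS iterSr -[fdiff c]/(fun m => c (1 + m)%N - c (0 + m)%N) iter_fdiffB.
by rewrite /=; ring.
Qed.

End FiniteDifferences.

(** Divide by N^2 and let N grow: this is how the diagonal error of order 1/N disappears. *)
Lemma ge0_of_affine_multiples (R : realType) (S B : R) :
  (forall N : nat, 0 <= N%:R ^+ 2 * S + N%:R * B) -> 0 <= S.
Proof.
move=> H; rewrite leNgt; apply/negP => S0.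
have [N BN] : exists N : nat, B / - S < N%:R.
  exists (Num.bound `|B / - S|).
  exact: le_lt_trans (ler_norm _) (archi_boundP (normr_ge0 _)).
have NB : B + N.+1%:R * S < 0.
  move: BN; rewrite ltr_pdivrMr ?oppr_gt0// mulrN -subr_lt0 opprK => BN.
  by rewrite -natr1 mulrDl; lra.
have := H N.+1; rewrite expr2 -mulrA -mulrDr pmulr_rge0 ?ltr0Sn//.
by rewrite addrC leNgt NB.
Qed.

Section Moments.
Context d (T : measurableType d) (R : realType) (P : probability T R).
Variable Y : nat -> {RV P >-> R}.
Hypothesis Yiid : iid Y.
Variables (p : nat) (F : 'I_p -> seq R -> R) (deg : 'I_p -> nat).
Hypothesis mF : forall j, seq_measurable (F j).
Hypothesis sF : forall j, seq_symmetric (F j).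
Hypothesis F2 : forall j s, uniq s -> size s = deg j ->
  F j \o sample Y s \in Lfun P 2%:E.

(* [E F_j(Y_A) F_k(Y_B)] for any [A], [B] of sizes [deg j], [deg k] with [m]
   common elements; a junk value unless [m <= deg j] and [m <= deg k]. *)
Definition cross_moment j k m : R :=
  mean P (fun w => F j (sample Y (iota 0 (deg j)) w) *
                   F k (sample Y (iota 0 m ++ iota (deg j) (deg k - m)) w)).

(** [sample_cross] against the reference pair of [cross_moment], whose second set continues beyond
    [deg j] and so meets the first exactly in [iota 0 m]. *)
Lemma cross_momentE j k A B : uniq A -> uniq B ->
  size A = deg j -> size B = deg k ->
  mean P (fun w => F j (sample Y A w) * F k (sample Y B w)) =
  cross_moment j k (count (mem B) A).
Proof.
move=> uA uB sA sB; set m := count _ _.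
have mA : (m <= deg j)%N by rewrite -sA count_size.
have mB : (m <= deg k)%N.
  rewrite -sB -[m]size_filter uniq_leq_size ?filter_uniq// => x.
  by rewrite mem_filter => /andP[].
have disj x : (x \in iota 0 m) && (x \in iota (deg j) (deg k - m)) = false.
  by rewrite !mem_iota; lia.
have uB' : uniq (iota 0 m ++ iota (deg j) (deg k - m)).
  rewrite cat_uniq !iota_uniq andbT; apply/hasPn => x xk.
  by apply/negP => xm; have := disj x; rewrite xk xm.
have sB' : size (iota 0 m ++ iota (deg j) (deg k - m)) = deg k.
  by rewrite size_cat !size_iota subnKC.
apply: sample_cross => //; rewrite ?iota_uniq ?size_iota ?sB'//.
- rewrite -/m.
  have -> : iota 0 (deg j) = iota 0 m ++ iota m (deg j - m).
    by rewrite -iotaD subnKC.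
  rewrite count_cat -[LHS]addn0; congr (_ + _)%N.
    rewrite -[LHS](size_iota 0); apply/esym/eqP; rewrite -all_count.
    by apply/allP => x xm /=; rewrite mem_cat xm.
  apply/esym/eqP; rewrite -leqn0 leqNgt -has_count; apply/hasPn => x.
  by rewrite /= mem_cat !mem_iota; lia.
- exact: F2.
- exact: F2.
Qed.

Definition hoeffding j k l : R := iter l fdiff (cross_moment j k) 0%N.

(* The alternating sums of [F_j] over the vertices of a cube, averaged over [N]
   disjoint blocks of [deg j - l] auxiliary variables, have covariance matrix
   [2 ^+ l *: hoeffding] up to an error [O(1/N)] on the diagonal. This avoids
   conditional expectations. *)
Lemma hoeffding_psd l (A : 'M[R]_p) : psd A ->
  (forall j k, A j k != 0 -> (l <= deg j)%N && (l <= deg k)%N) ->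
  0 <= \sum_j \sum_k A j k * hoeffding j k l.
Proof.
move=> A0 Asupp.
pose M := (\sum_j deg j)%N.
have degM j : (deg j <= M)%N by rewrite /M (bigD1 j)//= leq_addr.
(* Auxiliary indices start after the [l.*2] indices of the cube. Slots of width [M], numbered by
   [r * p + j], make the blocks of different pairs [(j, r)] disjoint. *)
pose Z (j : 'I_p) r := iota (l.*2 + M * (r * p + j)) (deg j - l).
have Zlow j r x : x \in Z j r -> (l.*2 <= x)%N by rewrite mem_iota; lia.
have Zdisj j k r q x : x \in Z j r -> x \in Z k q -> (j == k) && (r == q).
  rewrite !mem_iota => xj xk.
  have E : (r * p + j = q * p + k)%N.
    have := degM j; have := degM k; nia.
  have p0 : (0 < p)%N by apply: leq_ltn_trans (ltn_ord j).
  have E1 : r = q.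
    have := congr1 (divn^~ p) E.
    by rewrite !divnMDl// !divn_small// !addn0.
  apply/andP; split; last by rewrite E1.
  by apply/eqP/val_inj; move: E; rewrite E1 => /addnI.
(* The exceptional value when both factors use the same block: the overlap grows by the whole block
   length [deg j - l]. *)
pose b j := \sum_(x <- cube l) \sum_(y <- cube l)
  x.1 * y.1 * cross_moment j j (count (mem y.2) x.2 + (deg j - l))%N.
pose g j k := (2 : R) ^+ l * hoeffding j k l.
apply: (@ge0_of_affine_multiples _ _
  ((\sum_j A j j * (b j - g j j)) / 2 ^+ l)) => N.
pose idx := [seq (r, x) | r <- enum 'I_N, x <- @cube R l].
pose S (j : 'I_p) (i : 'I_N * (R * seq nat)) := i.2.2 ++ Z j i.1.
have idxP i : i \in idx -> i.2 \in cube l.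
  by move=> /allpairsP[[r x] [_ xl ->]].
have SP j i : (l <= deg j)%N -> i \in idx -> uniq (S j i) /\ size (S j i) = deg j.
  move=> lj /idxP /cube_spec[sz un /allP lt]; split.
    rewrite cat_uniq un iota_uniq andbT; apply/hasPn => x /Zlow lx.
    by apply/negP => /lt; lia.
  by rewrite size_cat sz size_iota subnKC.
(* The blocks are summed without dividing by [N], so the main term carries N^2 and the error N.
   Where [l > deg j] the row of [A] is zero and the value is immaterial. *)
pose X (j : 'I_p) w := if (l <= deg j)%N then
  \sum_(i <- idx) i.2.1 * F j (sample Y (S j i) w) else 0.
have X2 j : X j \in Lfun P 2%:E.
  rewrite /X; case: leqP => lj; last exact: Lfun_cst.
  by apply: Lfun2_sum => i iI; have [u s] := SP j i lj iI; exact: F2.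
have XE j k : A j k * mean P (fun w => X j w * X k w) =
    A j k * (N%:R ^+ 2 * g j k + (j == k)%:R * (N%:R * (b j - g j j))).
  have [->|Ajk] := eqVneq (A j k) 0; first by rewrite !mul0r.
  congr (_ * _); have /andP[lj lk] := Asupp j k Ajk.
  rewrite /X lj lk mean_bilinear; last 2 first.
  - by move=> i iI; have [u s] := SP j i lj iI; exact: F2.
  - by move=> i iI; have [u s] := SP k i lk iI; exact: F2.
  transitivity (\sum_(r < N) \sum_(q < N)
      (g j k + (j == k)%:R * (r == q)%:R * (b j - g j j))); last first.
    have -> : N%:R ^+ 2 * g j k + (j == k)%:R * (N%:R * (b j - g j j)) =
      \sum_(r < N) (N%:R * g j k + (j == k)%:R * (b j - g j j)).
      by rewrite sumr_const card_ord -mulr_natl; ring.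
    apply: eq_bigr => r _; rewrite big_split /= sumr_const card_ord mulr_natl.
    congr (_ + _); rewrite (bigD1 r)//= eqxx mulr1 big1 ?addr0// => q qr.
    by rewrite (eq_sym r) (negPf qr) mulr0 mul0r.
  transitivity (\sum_(r < N) \sum_(x <- cube l) \sum_(q < N) \sum_(y <- cube l)
    x.1 * y.1 * cross_moment j k
      (count (mem y.2) x.2 + ((j == k) && (r == q)) * (deg j - l))%N).
    rewrite big_allpairs big_enum; apply: eq_bigr => r _; apply: eq_big_seq => x xl.
    rewrite big_allpairs big_enum; apply: eq_bigr => q _; apply: eq_big_seq => y yl.
    have xI : (r, x) \in idx by apply: allpairs_f; rewrite ?mem_enum.
    have yI : (q, y) \in idx by apply: allpairs_f; rewrite ?mem_enum.
    have [ux sx] := SP j _ lj xI; have [uy sy] := SP k _ lk yI.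
    rewrite cross_momentE//=; congr (_ * cross_moment j k _).
    have [_ _ /allP xlow] := cube_spec xl; have [_ _ /allP ylow] := cube_spec yl.
    rewrite /S /= count_cat; congr (_ + _)%N.
      apply: eq_in_count => i /xlow ix; rewrite /= mem_cat orbC.
      by case: (boolP (i \in Z k q)) => // /Zlow; lia.
    have [/andP[/eqP jk /eqP rq]|jkrq] := boolP ((j == k) && (r == q)).
      rewrite mul1n -[RHS](size_iota (l.*2 + M * (r * p + j))).
      apply/eqP; rewrite -all_count; apply/allP => i iZ /=.
      by rewrite mem_cat -jk -rq iZ orbT.
    rewrite mul0n; apply/eqP; rewrite -leqn0 leqNgt -has_count; apply/hasPn => i iZ.
    rewrite /= mem_cat negb_or; apply/andP; split.
      by apply/negP => /ylow; have := Zlow _ _ _ iZ; lia.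
    apply: contra jkrq => iZ'; have := Zdisj _ _ _ _ _ iZ iZ'.
    by [].
  apply: eq_bigr => r _; rewrite exchange_big; apply: eq_bigr => q _.
  have [/andP[/eqP jk /eqP ->]|jkrq] := boolP ((j == k) && (r == q)).
    rewrite -jk !eqxx !mul1r addrC subrK.
    by under eq_bigr do under eq_bigr do rewrite mul1n.
  have -> : (j == k)%:R * (r == q)%:R = 0 :> R.
    by move: jkrq; case: (j == k); case: (r == q); rewrite ?mulr0 ?mul0r.
  rewrite mul0r addr0 /g /hoeffding -cube_sum.
  by under eq_bigr do under eq_bigr do rewrite mul0n addn0.
have := mean_psd A0 X2.
under eq_bigr do under eq_bigr do rewrite XE.
set Q := (X in 0 <= X -> _); move=> Q0.
rewrite -(@pmulr_rge0 _ (2 ^+ l)) ?exprn_gt0//.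
suff <- : Q = 2 ^+ l * (N%:R ^+ 2 * (\sum_j \sum_k A j k * hoeffding j k l) +
   N%:R * ((\sum_j A j j * (b j - g j j)) / 2 ^+ l)) by [].
have -> : 2 ^+ l * (N%:R ^+ 2 * (\sum_j \sum_k A j k * hoeffding j k l) +
   N%:R * ((\sum_j A j j * (b j - g j j)) / 2 ^+ l)) =
   N%:R ^+ 2 * 2 ^+ l * (\sum_j \sum_k A j k * hoeffding j k l) +
   N%:R * (\sum_j A j j * (b j - g j j)).
  have l0 : (2 : R) ^+ l != 0 by rewrite expf_neq0.
  by field.
rewrite !mulr_sumr -big_split; apply: eq_bigr => j _ /=.
rewrite mulr_sumr (bigD1 j)//= [in RHS](bigD1 j)//= eqxx.
have -> : \sum_(k < p | k != j) A j k *
      (N%:R ^+ 2 * g j k + (j == k)%:R * (N%:R * (b j - g j j))) =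
    \sum_(k < p | k != j) N%:R ^+ 2 * 2 ^+ l * (A j k * hoeffding j k l).
  by apply: eq_bigr => k kj; rewrite (eq_sym j) (negPf kj) mul0r addr0 /g; ring.
rewrite {1}/g mulr1n; ring.
Qed.

End Moments.

(** * Symmetric functions of tuples and the matrices R^(l) *)


Section Extension.
Context {R : realType} (m : nat).
Implicit Types f : m.-tuple R -> R.

(* Junk value [0] on sequences whose length is not [m]. *)
Definition tuple_ext f (s : seq R) : R := if insub s is Some t then f t else 0.

Lemma tuple_ext_val f (t : m.-tuple R) : tuple_ext f t = f t.
Proof. by rewrite /tuple_ext valK. Qed.

Lemma seq_measurable_ext f : measurable_fun setT f -> seq_measurable (tuple_ext f).
Proof.
move=> mf n; have [<-|mn] := eqVneq m n.
  by rewrite (_ : (fun _ => _) = f)//; apply/funext => t; rewrite tuple_ext_val.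
rewrite (_ : (fun _ => _) = cst 0); first exact: measurable_cst.
by apply/funext => t; rewrite /tuple_ext insubN// size_tuple eq_sym.
Qed.

Lemma seq_symmetric_ext f : symmetric_fun f -> seq_symmetric (tuple_ext f).
Proof.
move=> sf s s' ss'; have [sm|sm] := eqVneq (size s) m; last first.
  by rewrite /tuple_ext !insubN// -?(perm_size ss').
have sm' : size s' == m by rewrite -(perm_size ss') sm.
have {}sm : size s == m by rewrite sm.
pose t := Tuple sm; pose t' := Tuple sm'.
have /tuple_permP[q tq] : perm_eq t t' by [].
rewrite -[s]/(val t) -[s']/(val t') !tuple_ext_val -(sf q t').
by congr f; apply: val_inj; exact: tq.
Qed.

End Extension.

(** After multiplication by [l], the absorption identity l C(n, l) = n C(n-1, l-1) reduces this to
    monotonicity of C(., l-1). *)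
Lemma binomial_ratio_le (n a l : nat) : (0 < l)%N -> (n <= a)%N ->
  ('C(n, l) * a <= n * 'C(a, l))%N.
Proof.
case: l => // l _ na; rewrite -(@leq_pmul2l l.+1)//.
rewrite mulnA -[leqRHS]mulnCA; case: n na => [|n] na; first by rewrite bin0n muln0.
case: a na => // a na.
by rewrite -!mul_bin_diag -mulnA leq_mul2l mulnC leq_mul2l leq_bin2l ?orbT.
Qed.

Section RmxFacts.
Context {R : realType} (p : nat) (G : 'I_p -> {fset nat}).

Lemma Rmx_sym l : (Rmx R G l)^T = Rmx R G l.
Proof.
by apply/matrixP => j k; rewrite !mxE fsetIC -!mulrA (mulrC (Num.sqrt _)^-1).
Qed.

Lemma Rmx_ge0 l j k : 0 <= Rmx R G l j k.
Proof. by rewrite mxE !mulr_ge0// ?invr_ge0 sqrtr_ge0. Qed.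

(** Squared and cleared of denominators, this is the product of two instances of
    [binomial_ratio_le], one for each of [G j] and [G k]. If a denominator vanishes, the left side
    is 0 by convention. *)
Lemma Rmx_le l j k : (0 < l)%N -> Rmx R G l j k <= Rmx R G 1 j k.
Proof.
move=> l0; rewrite !mxE !bin1.
set n := #|` _ |%fset; set a := #|` G j|; set b := #|` G k|.
have na : (n <= a)%N by rewrite fsubset_leq_card// fsubsetIl.
have nb : (n <= b)%N by rewrite fsubset_leq_card// fsubsetIr.
have [a0|] := posnP 'C(a, l).
  by rewrite a0 sqrtr0 invr0 mulr0 mul0r !mulr_ge0// invr_ge0 sqrtr_ge0.
have [b0|b0 a0] := posnP 'C(b, l).
  by rewrite b0 sqrtr0 invr0 mulr0 !mulr_ge0// invr_ge0 sqrtr_ge0.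
have a1 : (0 < a)%N by rewrite bin_gt0 in a0; exact: leq_trans l0 a0.
have b1 : (0 < b)%N by rewrite bin_gt0 in b0; exact: leq_trans l0 b0.
rewrite -!mulrA -!invfM -!sqrtrM ?ler0n// ler_pdivrMr; last first.
  by rewrite sqrtr_gt0 -natrM ltr0n muln_gt0 a0.
rewrite mulrAC ler_pdivlMr; last by rewrite sqrtr_gt0 -natrM ltr0n muln_gt0 a1.
rewrite -(@ler_pXn2r _ 2)// ?nnegrE ?mulr_ge0 ?sqrtr_ge0//.
rewrite !exprMn !sqr_sqrtr ?mulr_ge0// -!natrM -!natrX -!natrM ler_nat.
have := leq_mul (binomial_ratio_le l0 na) (binomial_ratio_le l0 nb).
by rewrite /expn /=; lia.
Qed.

(** A nonzero numerator forces [l] below both cardinals, so the roots cancel; otherwise both sides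
    are 0. *)
Lemma Rmx_mul_sqrt l j k :
  Rmx R G l j k * (Num.sqrt 'C(#|` G j|, l)%:R * Num.sqrt 'C(#|` G k|, l)%:R) =
  'C(#|` G j `&` G k|%fset, l)%:R.
Proof.
rewrite mxE; set n := #|` G j `&` G k|%fset.
have na : (n <= #|` G j|)%N by rewrite fsubset_leq_card// fsubsetIl.
have nb : (n <= #|` G k|)%N by rewrite fsubset_leq_card// fsubsetIr.
have [n0|n0] := posnP 'C(n, l); first by rewrite n0 !mul0r.
have ln : (l <= n)%N by rewrite -bin_gt0.
have s0 a : (n <= a)%N -> Num.sqrt 'C(a, l)%:R != 0 :> R.
  move=> na'; rewrite gt_eqF// sqrtr_gt0 ltr0n bin_gt0; exact: leq_trans na'.
by field; rewrite !s0.
Qed.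

End RmxFacts.

(** * Bounds on the weighted correlation matrix *)


Lemma fine_covariance d (T : measurableType d) (R : realType)
    (P : probability T R) (X Z : T -> R) :
  fine (covariance P X Z) =
  mean P (fun w => (X w - mean P X) * (Z w - mean P Z)).
Proof. by rewrite unlock [in LHS]unlock. Qed.

Lemma count_mem_fset (A B : {fset nat}) : count (mem B) A = #|` A `&` B|%fset.
Proof.
rewrite -size_filter; apply: perm_size; apply: uniq_perm => [||x].
- by rewrite filter_uniq.
- exact: fset_uniq.
- by rewrite mem_filter !inE andbC.
Qed.

Section CorrelationBound.
Context d (T : measurableType d) (R : realType) (P : probability T R).
Variable Y : nat -> {RV P >-> R}.
Hypothesis Yiid : iid Y.
Variables (p : nat) (G : 'I_p -> {fset nat}).
Variable f : forall j : 'I_p, #|` G j|.-tuple R -> R.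
Arguments f : clear implicits.
Hypothesis fS : symm_class Y f.

Let c j := mean P (f j \o subvector Y (G j)).
Let F j s := tuple_ext (f j) s - c j.
Let m j := #|` G j|.
Let v j := fine 'V_P[f j \o subvector Y (G j)].

Let mF j : seq_measurable (F j).
Proof.
move=> n; apply: measurable_funB => //.
by apply: seq_measurable_ext; have [] := fS j.
Qed.

Let sF j : seq_symmetric (F j).
Proof.
by move=> s s' ss'; congr (_ - _); apply: seq_symmetric_ext ss'; have [] := fS j.
Qed.

Let F_subvector j w : F j (sample Y (G j) w) = f j (subvector Y (G j) w) - c j.
Proof. by rewrite /F -tuple_ext_val. Qed.

Let F2_subvector j : F j \o sample Y (G j) \in Lfun P 2%:E.
Proof.
apply/Lfun2P; split; first exact: measurable_sample.
have [_ _ _] := fS j; rewrite [in X in X -> _]/variance unlock unlock.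
apply: le_lt_trans; rewrite le_eqVlt; apply/orP; left; apply/eqP.
by apply: eq_integral => w _; rewrite /= F_subvector.
Qed.

Let F2 j s : uniq s -> size s = m j -> F j \o sample Y s \in Lfun P 2%:E.
Proof.
move=> us sj.
exact: (Lfun2_sample Yiid (mF j) (fset_uniq (G j)) us (esym sj) (F2_subvector j)).
Qed.

Let covE j k :
  fine (covariance P (f j \o subvector Y (G j)) (f k \o subvector Y (G k))) =
  cross_moment Y F m j k #|` G j `&` G k|%fset.
Proof.
rewrite fine_covariance -count_mem_fset -(cross_momentE Yiid mF sF F2) ?fset_uniq//.
by congr mean; apply/funext => w; rewrite !F_subvector.
Qed.

Let mean_centered j s : uniq s -> size s = m j -> mean P (F j \o sample Y s) = 0.
Proof.
move=> us sj; rewrite (mean_sample Yiid (s' := G j)) ?F2 ?fset_uniq//.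
(* The difference is written as a two-term sum over booleans to fit [mean_sum]. *)
rewrite (_ : F j \o _ = fun w => \sum_(i <- [:: true; false])
    (if i then 1 else -1) * (if i then f j \o subvector Y (G j) else cst (c j)) w);
    last first.
  by apply/funext => w; rewrite /= F_subvector !big_cons big_nil /=; ring.
have fL2 : f j \o subvector Y (G j) \in Lfun P 2%:E.
  rewrite (_ : _ \o _ = (F j \o sample Y (G j)) \+ cst (c j)).
    have l12 : (1 <= 2%:E :> \bar R)%E by rewrite lee_fin ler1n.
    have [_ ->//] := Lfun_addr_closed P l12; exact: Lfun_cst.
  by apply/funext => w; rewrite /= F_subvector subrK.
rewrite mean_sum => [|[] _]; last 2 first.
- exact: Lfun2_integrable.
- by apply: Lfun2_integrable; exact: Lfun_cst.
by rewrite !big_cons big_nil /= -/(c j) mean_cst; ring.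
Qed.

Let hoeffding0 j k : hoeffding Y F m j k 0 = 0.
Proof.
rewrite /hoeffding /= /cross_moment subn0 /= sample_indep//.
- by rewrite mean_centered ?mul0r ?iota_uniq ?size_iota.
- rewrite cat_uniq !iota_uniq andbT /=; apply/hasPn => x.
  by rewrite /= !mem_iota; lia.
- by rewrite F2 ?iota_uniq ?size_iota.
- by rewrite F2 ?iota_uniq ?size_iota.
Qed.

Let n_le j : (m j <= ell_star G)%N.
Proof. exact: leq_bigmax. Qed.

Let vE j : v j = \sum_(l < (ell_star G).+1) 'C(m j, l)%:R * hoeffding Y F m j j l.
Proof.
by rewrite /v [fine _]covE fsetIid; apply: newton_forward; exact: n_le.
Qed.

Let v_gt0 j : 0 < v j.
Proof.
have [_ _ v0 voo] := fS j; apply: fine_gt0.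
by rewrite v0 voo.
Qed.

(** The hypothesis says that R^(l) o W minus [lam] times the identity is nonnegative on vectors
    supported on J^(l). Scaling both sides by [D], which vanishes off J^(l), gives a positive
    semidefinite [A] to be paired with [hoeffding]. *)
Let component_bound (W : 'M[R]_p) (lam : R) (u : 'I_p -> R) l :
  W^T = W ->
  (forall x : 'I_p -> R, (forall j, (m j < l)%N -> x j = 0) ->
     lam * sqn x <= qform (schur (Rmx R G l) W) x) ->
  lam * (\sum_j u j ^+ 2 / v j * ('C(m j, l)%:R * hoeffding Y F m j j l)) <=
  \sum_j \sum_k W j k * ('C(#|` G j `&` G k|%fset, l)%:R * hoeffding Y F m j k l)
     * (u j / Num.sqrt (v j) * (u k / Num.sqrt (v k))).
Proof.
move=> Ws lamP.
pose D j := u j / Num.sqrt (v j) * Num.sqrt 'C(m j, l)%:R.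
pose A : 'M[R]_p := \matrix_(j, k)
  (D j * D k * (Rmx R G l j k * W j k - lam * (j == k)%:R)).
have D0 j : (m j < l)%N -> D j = 0.
  by move=> jl; rewrite /D bin_small// sqrtr0 mulr0.
have A0 : psd A.
  move=> x; have := lamP (fun j => D j * x j).
  have H : forall j, (m j < l)%N -> D j * x j = 0 by move=> j /D0 ->; rewrite mul0r.
  move=> /(_ H); rewrite -subr_ge0 => H'; apply: le_trans H' _.
  rewrite le_eqVlt; apply/orP; left; apply/eqP.
  rewrite /qform /bform /sqn mulr_sumr -sumrB; apply: eq_bigr => j _.
  have E k : A j k * (x j * x k) = schur (Rmx R G l) W j k * (D j * x j * (D k * x k))
      - (j == k)%:R * (lam * (D j * x j * (D k * x k))).
    by rewrite [A j k]mxE [schur _ _ j k]mxE; ring.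
  under [RHS]eq_bigr do rewrite E.
  rewrite sumrB; congr (_ - _); rewrite (bigD1 j)//= big1 ?addr0 => [|k kj].
    by rewrite eqxx mul1r expr2.
  by rewrite eq_sym (negPf kj) mul0r.
have Asupp j k : A j k != 0 -> (l <= m j)%N && (l <= m k)%N.
  rewrite mxE => Ajk; apply/andP; split; rewrite leqNgt; apply: contra Ajk => /D0 ->.
    by rewrite !mul0r.
  by rewrite mulr0 mul0r.
have H0 := hoeffding_psd Yiid mF sF F2 A0 Asupp.
rewrite -subr_ge0; apply: le_trans H0 _; rewrite le_eqVlt; apply/orP; left; apply/eqP.
rewrite mulr_sumr -sumrB; apply: eq_bigr => j _.
have E k : A j k * hoeffding Y F m j k l =
   W j k * ('C(#|` G j `&` G k|%fset, l)%:R * hoeffding Y F m j k l)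
     * (u j / Num.sqrt (v j) * (u k / Num.sqrt (v k)))
   - (j == k)%:R * (lam * (D j * D k) * hoeffding Y F m j k l).
  rewrite mxE -(Rmx_mul_sqrt (R := R) G l j k) /D -/(m j) -/(m k); ring.
under eq_bigr do rewrite E.
rewrite sumrB; congr (_ - _).
rewrite (bigD1 j)//= big1 ?addr0 => [|k kj]; last by rewrite eq_sym (negPf kj) mul0r.
have D2 : D j * D j = u j ^+ 2 / v j * 'C(m j, l)%:R.
  by rewrite /D -expr2 exprMn exprMn exprVn !sqr_sqrtr ?ler0n// ltW.
by rewrite eqxx mul1r D2; ring.
Qed.

Lemma corr_weighted_lb (W : 'M[R]_p) (lam : R) (u : 'I_p -> R) :
  W^T = W ->
  (forall l (x : 'I_p -> R), (0 < l <= ell_star G)%N ->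
     (forall j, (#|` G j| < l)%N -> x j = 0) ->
     lam * sqn x <= qform (schur (Rmx R G l) W) x) ->
  lam * sqn u <= qform (corr_weighted Y W f) u.
Proof.
move=> Ws lamP; pose L := (ell_star G).+1.
(* Each [u j ^+ 2] is shared among the orders in proportion to their part of the variance [v j], as
   given by [vE]. *)
have -> : sqn u = \sum_(l < L) \sum_j u j ^+ 2 / v j *
    ('C(m j, l)%:R * hoeffding Y F m j j l).
  rewrite exchange_big; apply: eq_bigr => j _.
  by rewrite -mulr_sumr -vE divfK// gt_eqF.
have -> : qform (corr_weighted Y W f) u = \sum_(l < L) \sum_j \sum_k W j k *
    ('C(#|` G j `&` G k|%fset, l)%:R * hoeffding Y F m j k l)
     * (u j / Num.sqrt (v j) * (u k / Num.sqrt (v k))).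
  rewrite exchange_big; apply: eq_bigr => j _.
  rewrite exchange_big; apply: eq_bigr => k _.
  rewrite -mulr_suml -mulr_sumr mxE /corr covE (@newton_forward _ _ _ (ell_star G)).
    by rewrite -/(v j) -/(v k) -/L invfM; ring.
  by apply: leq_trans (n_le j); rewrite fsubset_leq_card// fsubsetIl.
rewrite mulr_sumr; apply: ler_sum => -[[|l] lL] _ /=.
  rewrite big1 ?mulr0; last by move=> j _; rewrite hoeffding0 !mulr0.
  rewrite big1// => j _; rewrite big1// => k _.
  by rewrite hoeffding0 !(mulr0, mul0r).
by apply: component_bound => // x; apply: lamP; rewrite -ltnS.
Qed.

End CorrelationBound.

(** * U-statistics *)


Section Kernels.
Context d (T : measurableType d) (R : realType) (P : probability T R).
Variable Y : nat -> {RV P >-> R}.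
Hypothesis Yiid : iid Y.

Lemma Lfun2_bounded (X : T -> R) M :
  measurable_fun setT X -> (forall w, `|X w| <= M) -> X \in Lfun P 2%:E.
Proof.
move=> mX XM; apply/Lfun2P; split => //.
have : (\int[P]_w (cst (M ^+ 2)%:E) w < +oo)%E.
  by rewrite integral_cst//= probability_setT mule1 ltry.
apply: le_lt_trans; apply: ge0_le_integral => //.
- by move=> w _; rewrite lee_fin sqr_ge0.
- by apply/measurable_EFinP; exact: measurable_funX.
- move=> w _; rewrite lee_fin -(real_normK (num_real (X w))).
  by rewrite lerXn2r ?nnegrE// (le_trans _ (XM w)).
Qed.

(** One index is split off at a time by two-sample independence; the uniform bound [M] supplies
    integrability. *)
Lemma mean_prod (s : seq nat) (g : nat -> R -> R) M : uniq s ->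
  (forall i, measurable_fun setT (g i)) -> (forall i x, `|g i x| <= M) ->
  mean P (fun w => \prod_(i <- s) g i (Y i w)) =
  \prod_(i <- s) mean P (g i \o Y i).
Proof.
move=> + mg gM; elim: s => [_|i s IH /= /andP[si us]].
  rewrite big_nil; transitivity (mean P (cst 1)); last exact: mean_cst.
  by congr mean; apply/funext => w; rewrite big_nil.
pose G (x : seq R) := \prod_(k < size s) g (nth 0%N s k) (nth 0 x k).
have GE w : G (sample Y s w) = \prod_(j <- s) g j (Y j w).
  rewrite (big_nth 0%N) big_mkord; apply: eq_bigr => k _.
  by rewrite (nth_map 0%N).
have mG : seq_measurable G.
  move=> n; apply: measurable_prod => k _.
  by apply: (measurableT_comp (mg (nth 0%N s k))); exact: measurable_nth.
have mgi : seq_measurable (fun x => g i (nth 0 x 0)).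
  by move=> n; apply: (measurableT_comp (mg i)); exact: measurable_nth.
rewrite big_cons -(IH us); rewrite (_ : (fun w => _) =
    fun w => g i (nth 0 (sample Y [:: i] w) 0) * G (sample Y s w)); last first.
  by apply/funext => w; rewrite GE big_cons.
rewrite (sample_indep Yiid mgi mG); last 3 first.
- by rewrite /= si.
- apply: (@Lfun2_bounded _ M) => [|w]; last exact: gM.
  exact: (measurable_sample Y [:: i] mgi).
- apply: (@Lfun2_bounded _ (\prod_(k < size s) M)).
    exact: measurable_sample.
  move=> w; rewrite /= /G normr_prod.
  by apply: ler_prod => k _; rewrite normr_ge0 gM.
by congr (_ * mean _ _); apply/funext => w; rewrite /= GE.
Qed.

Lemma mean_ident (g : R -> R) M i : measurable_fun setT g ->
  (forall x, `|g x| <= M) -> mean P (g \o Y i) = mean P (g \o Y 0%N).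
Proof.
move=> mg gM; pose F (x : seq R) := g (nth 0 x 0).
have mF : seq_measurable F.
  by move=> n; apply: (measurableT_comp mg); exact: measurable_nth.
apply: (@mean_sample _ _ _ _ _ Yiid F [:: i] [:: 0%N]) => //.
apply: (@Lfun2_bounded _ M) => [|w]; last exact: gM.
exact: (measurable_sample Y [:: i] mF).
Qed.

End Kernels.

(** The kernel is arctan minus its mean [mu]: bounded whatever the law of [X]. By injectivity of
    arctan, zero variance would put all mass of [X] at [tan mu]. *)
Lemma nondegenerate_kernel d (T : measurableType d) (R : realType)
    (P : probability T R) (X : {RV P >-> R}) : nondegenerate_rv X ->
  exists h : R -> R, [/\ measurable_fun setT h, exists M, forall x, `|h x| <= M,
    mean P (h \o X) = 0 & 0 < mean P (fun w => h (X w) ^+ 2)].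
Proof.
move=> Xnd; pose mu := mean P (@atan R \o X).
pose h x := atan x - mu.
have mh : measurable_fun setT h.
  apply: measurable_funB => //.
  by apply: continuous_measurable_fun => x; exact: continuous_atan.
have atanM x : `|atan x| <= pi / 2 :> R.
  by rewrite ler_norml !ltW ?atan_gtNpi2 ?atan_ltpi2.
have hM x : `|h x| <= pi / 2 + `|mu|.
  by rewrite (le_trans (ler_normB _ _))// lerD2r.
have mX : measurable_fun setT X by exact: measurable_funP.
have mhX : measurable_fun setT (h \o X) by exact: measurableT_comp.
have matX : measurable_fun setT (@atan R \o X).
  rewrite (_ : _ \o _ = (h \o X) \+ cst mu).
    by apply: measurable_funD.
  by apply/funext => w; rewrite /= /h subrK.
exists h; split=> //.
- by exists (pi / 2 + `|mu|).
- rewrite (_ : h \o X = fun w => \sum_(i <- [:: true; false])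
    (if i then 1 else -1) * (if i then @atan R \o X else cst mu) w); last first.
    by apply/funext => w; rewrite !big_cons big_nil /= /h; ring.
  rewrite mean_sum => [|[] _]; last 2 first.
  + by apply: Lfun2_integrable; apply: Lfun2_bounded => // w; exact: atanM.
  + by apply: Lfun2_integrable; exact: Lfun_cst.
  by rewrite !big_cons big_nil /= -/mu mean_cst; ring.
have h2 : h \o X \in Lfun P 2%:E by apply: Lfun2_bounded => // w; exact: hM.
rewrite lt_neqAle; apply/andP; split; last first.
  by apply: Rintegral_ge0 => w _; exact: sqr_ge0.
apply/negP => /eqP m0; apply: (Xnd (tan mu)).
have mh2 : measurable_fun setT (fun w => ((h (X w)) ^+ 2)%:E).
  by apply/measurable_EFinP; exact: measurable_funX.
have : (\int[P]_w `|((h (X w)) ^+ 2)%:E| = 0)%E.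
  rewrite -[RHS]/(0%R%:E) m0 /mean /Rintegral fineK.
    by apply: eq_integral => w _; rewrite gee0_abs// lee_fin sqr_ge0.
  by apply: integrable_fin_num => //; exact: (Lfun2_integrable_sqr h2).
move=> /(ae_eq_integral_abs _ measurableT mh2) ae0.
have mA : measurable (X @^-1` [set tan mu]).
  by rewrite -[X in measurable X]setTI; exact: mX.
have PA : P (~` (X @^-1` [set tan mu])) = 0%E.
  apply: measure_negligible; first exact: measurableC.
  apply: negligibleS ae0 => w /= Xw H; apply: Xw.
  have := H I => /= -[] /eqP; rewrite sqrf_eq0 => /eqP hw.
  by rewrite -(atanK (X w)); congr tan; apply/eqP; rewrite -subr_eq0; apply/eqP.
have := probability_setC P (measurableC mA); rewrite setCK PA sube0.
by [].
Qed.


Section DrawsFromFset.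
Variable n : nat.
Implicit Types A B : {fset nat}.

Definition ord_fset A : {set 'I_n} := [set i : 'I_n | (i : nat) \in A]%SET.

Lemma card_ord_fset A : (forall i, i \in A -> (i < n)%N) -> #|ord_fset A| = #|` A|.
Proof.
move=> An; rewrite cardE -(size_map val); apply: perm_size; apply: uniq_perm => [||i].
- by rewrite map_inj_uniq ?enum_uniq//; exact: val_inj.
- exact: fset_uniq.
apply/mapP/idP => [[x]|iA]; first by rewrite mem_enum inE => xA ->.
by exists (Ordinal (An i iA)) => //; rewrite mem_enum inE.
Qed.

(** The product of the two indicators selects the [l]-subsets of the intersection. It serves both
    the covariances of U-statistics and the Gram matrix of the shifted family. *)
Lemma sum_common_draws (R : realType) A B l (z : R) :
  (forall i, i \in A -> (i < n)%N) ->
  \sum_(S : {set 'I_n}) ((S \subset ord_fset A) && (#|S| == l))%:R *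
    ((S \subset ord_fset B) && (#|S| == l))%:R * z =
  'C(#|` A `&` B|%fset, l)%:R * z.
Proof.
move=> An; rewrite -card_ord_fset => [|i]; last by rewrite inE => /andP[/An].
have -> : ord_fset (A `&` B)%fset = ord_fset A :&: ord_fset B.
  by apply/setP => i; rewrite !inE.
rewrite -cards_draws mulr_natl -sumr_const [RHS]big_mkcond; apply: eq_bigr => S _.
rewrite inE finset.subsetI; have [_|_] := eqVneq #|S| l; last by rewrite !andbF !mul0r.
by rewrite !andbT; do 2 case: (S \subset _); rewrite ?(mul0r, mul1r).
Qed.

End DrawsFromFset.

Lemma fset_family_bound p (G : 'I_p -> {fset nat}) j i :
  i \in G j -> (i < (\sum_j \sum_(i <- G j) i).+1)%N.
Proof.
move=> iG; rewrite ltnS (bigD1 j)//=; apply: leq_trans (leq_addr _ _).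
by rewrite (big_rem i)//= leq_addr.
Qed.

Section UStatistics.
Context {R : realType}.
Implicit Type h : R -> R.

(** The elementary symmetric polynomial of degree [l] in the values of [h], unnormalized since
    correlations ignore scale. *)
Definition ustat h (l m : nat) (y : m.-tuple R) : R :=
  \sum_(S : {set 'I_m} | #|S| == l) \prod_(i in S) h (tnth y i).

Lemma measurable_ustat h l m : measurable_fun setT h ->
  measurable_fun setT (@ustat h l m).
Proof.
move=> mh; have mhi i : measurable_fun [set: m.-tuple R] (fun y => h (tnth y i)).
  by apply: (measurableT_comp mh); exact: measurable_tnth.
have mS (S : {set 'I_m}) : measurable_fun [set: m.-tuple R]
    (fun y => if #|S| == l then \prod_(i <- enum S) h (tnth y i) else 0).
  case: (#|S| == l); last exact: measurable_cst.
  exact: (measurable_prod (fun i _ => mhi i)).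
rewrite (_ : @ustat h l m = fun y => \sum_(S : {set 'I_m})
    if #|S| == l then \prod_(i <- enum S) h (tnth y i) else 0).
  exact: (measurable_sum _ mS).
apply/funext => y; rewrite /ustat big_mkcond; apply: eq_bigr => S _.
by rewrite big_enum.
Qed.

Lemma symmetric_ustat h l m : symmetric_fun (@ustat h l m).
Proof.
move=> s y; rewrite /ustat [RHS](reindex_inj (imset_inj (@perm_inj _ s))).
apply: eq_big => [S|S _]; first by rewrite card_imset//; exact: perm_inj.
rewrite big_imset; last by move=> i j _ _; exact: perm_inj.
by apply: eq_bigr => i _; rewrite tnth_mktuple.
Qed.

(** Subsets of positions are carried to subsets of one ambient range, so that the statistics of
    different sets expand in the same family of products. *)
Lemma ustat_ambient d (T : measurableType d) (P : probability T R)
    (Y : nat -> {RV P >-> R}) h l n (A : {fset nat}) w :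
  (forall i, i \in A -> (i < n.+1)%N) ->
  ustat h l (subvector Y A w) =
  \sum_(S : {set 'I_n.+1})
    ((S \subset ord_fset n.+1 A) && (#|S| == l))%:R *
    \prod_(i in S) h (Y i w).
Proof.
move=> An; pose phi (k : 'I_#|` A|) : 'I_n.+1 := inord (nth 0%N A k).
have phiA k : (phi k : nat) = nth 0%N A k.
  by rewrite inordK// An// mem_nth.
have phi_inj : injective phi.
  move=> k k' /(congr1 val) /=; rewrite !phiA => /eqP.
  by rewrite nth_uniq ?fset_uniq// => /eqP/val_inj.
have phi_im (i : 'I_n.+1) : (i : nat) \in A -> exists k, phi k = i.
  move=> iA; have ki : (index (i : nat) A < #|` A|)%N by rewrite index_mem.
  by exists (Ordinal ki); apply: val_inj; rewrite /= phiA nth_index.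
under [RHS]eq_bigr do rewrite mulr_natl mulrb.
rewrite -big_mkcond /= (reindex_onto (fun S : {set 'I_#|` A|} => phi @: S)
  (fun S' => phi @^-1: S')) /=.
  apply: eq_big => [S|S _].
    have -> : phi @^-1: (phi @: S) = S.
      by apply/setP => k; rewrite inE mem_imset.
    have -> : phi @: S \subset ord_fset n.+1 A.
      by apply/fintype.subsetP => _ /imsetP[k _ ->]; rewrite inE phiA; exact: mem_nth.
    by rewrite eqxx andbT card_imset.
  rewrite big_imset; last by move=> i j _ _; exact: phi_inj.
  apply: eq_bigr => k _; rewrite phiA; congr h.
  by rewrite (tnth_nth 0) /= (nth_map 0%N).
move=> S' /andP[/fintype.subsetP S'A _]; apply/setP => i; apply/imsetP/idP => [[k]|iS'].
  by rewrite inE => ? ->.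
have iA : (i : nat) \in A by have := S'A i iS'; rewrite inE.
have [k ki] := phi_im i iA.
by exists k => //; rewrite inE ki.
Qed.

End UStatistics.

Section UStatisticsCorrelation.
Context d (T : measurableType d) (R : realType) (P : probability T R).
Variable Y : nat -> {RV P >-> R}.
Hypothesis Yiid : iid Y.
Variables (h : R -> R) (M : R).
Hypothesis mh : measurable_fun setT h.
Hypothesis hM : forall x, `|h x| <= M.
Hypothesis h_mean : mean P (h \o Y 0%N) = 0.
Let v := mean P (fun w => h (Y 0%N w) ^+ 2).
Hypothesis v_gt0 : 0 < v.

(** An index lying in exactly one of the two sets contributes the factor E h(Y) = 0, so distinct
    products are orthogonal. *)
Lemma mean_prod_sets n (S S' : {set 'I_n.+1}) :
  mean P (fun w => (\prod_(i in S) h (Y i w)) * (\prod_(i in S') h (Y i w))) =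
  (S == S')%:R * v ^+ #|S|.
Proof.
pose e (i : nat) : nat := ((inord i \in S) + (inord i \in S'))%N.
have le2 i : (e i < 3)%N by rewrite /e; do 2 case: (_ \in _).
(* At least 1, so that [B ^+ 2] bounds the powers of [h] with exponents 0, 1 and 2 alike. *)
pose B := Num.max M 1.
have mg i : measurable_fun setT (fun x => h x ^+ e i).
  exact: measurable_funX.
have gB i x : `|h x ^+ e i| <= B ^+ 2.
  have B1 : 1 <= B by rewrite /B le_max lexx orbT.
  have hB : `|h x| <= B by rewrite /B le_max hM.
  rewrite normrX; apply: (@le_trans _ _ (B ^+ e i)).
    by rewrite lerXn2r ?nnegrE ?(le_trans ler01 B1).
  by rewrite ler_weXn2l// -ltnS.
have prod_iota (F : nat -> R) : \prod_(i <- iota 0 n.+1) F i = \prod_(i < n.+1) F i.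
  by rewrite -(big_mkord xpredT) /index_iota subn0.
transitivity (mean P (fun w => \prod_(i <- iota 0 n.+1) h (Y i w) ^+ e i)).
  congr mean; apply/funext => w; rewrite prod_iota.
  rewrite big_mkcond [X in _ * X]big_mkcond -big_split; apply: eq_bigr => i _ /=.
  rewrite /e inord_val; case: (i \in S); case: (i \in S');
    by rewrite ?mulr1 ?mul1r ?expr0 ?expr1 ?expr2.
rewrite (mean_prod Yiid _ mg gB) ?iota_uniq//.
rewrite prod_iota.
have mom i : mean P ((fun x => h x ^+ e i) \o Y i) =
    if e i is e'.+1 then if e' is 0 then 0 else v else 1.
  rewrite (mean_ident Yiid i (mg i) (gB i)); move: (le2 i).
  case: (e i) => [|[|[|]]]// _; first exact: mean_cst.
have [eSS'|SS'] := eqVneq S S'.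
  rewrite mul1r -prodr_const [RHS]big_mkcond; apply: eq_bigr => i _.
  by rewrite mom /e inord_val -eSS'; case: (i \in S).
have [i iSS'] : exists i, (i \in S) != (i \in S').
  by apply/existsP; apply: contraNT SS' => /existsPn H; apply/eqP/setP => i;
    apply/eqP; have := H i; rewrite negbK.
rewrite mul0r (bigD1 i)//= mom /e inord_val.
by move: iSS'; case: (i \in S); case: (i \in S') => // _; rewrite mul0r.
Qed.

Variables (p : nat) (G : 'I_p -> {fset nat}) (deg : 'I_p -> nat).
Hypothesis deg_gt0 : forall j, (0 < deg j)%N.
Hypothesis deg_le : forall j, (deg j <= #|` G j|)%N.

Let f (j : 'I_p) := @ustat R h (deg j) #|` G j|.
Arguments f : clear implicits.
Let n := (\sum_j \sum_(i <- G j) i)%N.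

Let a j (S : {set 'I_n.+1}) : R :=
  ((S \subset ord_fset n.+1 (G j)) && (#|S| == deg j))%:R.

Let X (S : {set 'I_n.+1}) (w : T) : R := \prod_(i in S) h (Y i w).

Let fE j : f j \o subvector Y (G j) = fun w => \sum_S a j S * X S w.
Proof. by apply/funext => w; rewrite /= /f (ustat_ambient _ _ _ _ (@fset_family_bound _ G j)). Qed.

Let X2 S : X S \in Lfun P 2%:E.
Proof.
apply: (@Lfun2_bounded _ _ _ P _ (\prod_(i in S) M)) => [|w].
  rewrite (_ : X S = fun w => \prod_(i <- enum S) h (Y i w)).
    apply: measurable_prod => i _; apply: (measurableT_comp mh).
    exact: measurable_funP.
  by apply/funext => w; rewrite big_enum.
by rewrite normr_prod; apply: ler_prod => i _; rewrite normr_ge0 hM.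
Qed.

Let f2 j : f j \o subvector Y (G j) \in Lfun P 2%:E.
Proof. by rewrite fE; apply: Lfun2_sum => S _; exact: X2. Qed.

Let mean_f j : mean P (f j \o subvector Y (G j)) = 0.
Proof.
rewrite fE mean_sum => [|S _]; last exact: Lfun2_integrable.
rewrite big1// => S _.
have -> : mean P (X S) = (S == finset.set0)%:R * v ^+ #|S|.
  rewrite -mean_prod_sets; congr mean; apply/funext => w.
  by rewrite big_set0 mulr1.
have [->|_] := eqVneq S finset.set0; last by rewrite mul0r mulr0.
by rewrite /a cards0 eq_sym (gtn_eqF (deg_gt0 j)) andbF mul0r.
Qed.

Let cov_f j k :
  fine (covariance P (f j \o subvector Y (G j)) (f k \o subvector Y (G k))) =
  \sum_S a j S * a k S * v ^+ #|S|.
Proof.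
rewrite fine_covariance !mean_f.
transitivity (mean P (fun w => (\sum_S a j S * X S w) * (\sum_S a k S * X S w))).
  congr mean; apply/funext => w; rewrite !subr0.
  exact: (congr2 (fun x y => x * y) (congr1 (@^~ w) (fE j)) (congr1 (@^~ w) (fE k))).
rewrite mean_bilinear => [|S _|S _]; [|exact: X2|exact: X2].
apply: eq_bigr => S _; rewrite (bigD1 S)//= mean_prod_sets eqxx mul1r big1 ?addr0//.
by move=> S' SS'; rewrite mean_prod_sets eq_sym (negPf SS') mul0r mulr0.
Qed.

Let cov_same j k : deg j = deg k ->
  fine (covariance P (f j \o subvector Y (G j)) (f k \o subvector Y (G k))) =
  'C(#|` G j `&` G k|%fset, deg j)%:R * v ^+ deg j.
Proof.
move=> djk; rewrite cov_f -(@sum_common_draws n.+1); last exact: fset_family_bound.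
apply: eq_bigr => S _; rewrite /a -djk.
by have [->|_] := eqVneq #|S| (deg j); last by rewrite !andbF !mul0r.
Qed.

Let binG_gt0 j : 0 < 'C(#|` G j|, deg j)%:R * v ^+ deg j.
Proof. by rewrite mulr_gt0 ?exprn_gt0// ltr0n bin_gt0. Qed.

Lemma ustat_symm_class : symm_class Y f.
Proof.
move=> j; split.
- exact: measurable_ustat.
- exact: symmetric_ustat.
- rewrite -(fineK (variance_fin_num (f2 j))) lte_fin [fine _]cov_same// fsetIid.
  exact: binG_gt0.
- by rewrite -(fineK (variance_fin_num (f2 j))) ltry.
Qed.

Lemma ustat_corr j k : deg j = deg k ->
  corr P (f j \o subvector Y (G j)) (f k \o subvector Y (G k)) =
  Rmx R G (deg j) j k.
Proof.
move=> djk; rewrite /corr cov_same// [fine 'V_P[_]]cov_same// [fine 'V_P[_]]cov_same//.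
rewrite !fsetIid mxE -djk !sqrtrM ?ler0n//.
have v0 : v ^+ deg j != 0 by rewrite gt_eqF// exprn_gt0.
have vs : Num.sqrt (v ^+ deg j) * Num.sqrt (v ^+ deg j) = v ^+ deg j.
  by rewrite -expr2 sqr_sqrtr// exprn_ge0// ltW.
by rewrite mulrACA vs !invfM mulrACA mulfV// mulr1 mulrA.
Qed.

End UStatisticsCorrelation.

(** * Principal submatrices and the shifted family *)


Section PrincipalSubmatrix.
Context {R : realType} {n : nat}.
Implicit Types (A K : 'M[R]_n) (J : {set 'I_n}) (x : 'I_n -> R).

Lemma sum_enum_val J (F : 'I_n -> R) : (forall j, j \notin J -> F j = 0) ->
  \sum_j F j = \sum_(i < #|J|) F (enum_val i).
Proof.
move=> F0; rewrite -(big_enum_val F) (bigID (mem J)) /= [X in _ + X]big1 ?addr0//.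
Qed.

Lemma sqn_enum_val J x : (forall j, j \notin J -> x j = 0) ->
  sqn x = sqn (fun i : 'I_#|J| => x (enum_val i)).
Proof. by move=> x0; apply: sum_enum_val => j /x0 ->; rewrite expr0n. Qed.

Lemma qform_enum_val A J x : (forall j, j \notin J -> x j = 0) ->
  qform A x = qform (principal_submx A J) (fun i => x (enum_val i)).
Proof.
move=> x0; rewrite /qform /bform (sum_enum_val (J := J)); last first.
  by move=> j /x0 xj; rewrite big1// => k _; rewrite xj mul0r mulr0.
apply: eq_bigr => i _; rewrite (sum_enum_val (J := J)).
  by apply: eq_bigr => k _; rewrite mxE.
by move=> k /x0 ->; rewrite !mulr0.
Qed.

Lemma principal_submx_sym A J :
  A^T = A -> (principal_submx A J)^T = principal_submx A J.
Proof. by move=> As; apply/matrixP => i k; rewrite !mxE -[in LHS]As mxE. Qed.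

Lemma lambda_min_principal_lb A J x : (0 < #|J|)%N -> A^T = A ->
  (forall j, j \notin J -> x j = 0) ->
  lambda_min (principal_submx A J) * sqn x <= qform A x.
Proof.
move=> J0 As x0; rewrite (sqn_enum_val x0) (qform_enum_val _ x0).
by apply: lambda_min_lb => //; exact: principal_submx_sym.
Qed.

(** Extend a test vector by 0 outside [J]. Agreement is asked on [J] only, which leaves the
    functions attached to other indices free. *)
Lemma lambda_min_le_principal A K J : (0 < #|J|)%N -> A^T = A -> K^T = K ->
  {in J &, forall j k, K j k = A j k} ->
  lambda_min K <= lambda_min (principal_submx A J).
Proof.
move=> J0 As Ks KA; have [j0 j0J] : exists j0, j0 \in J by apply/card_gt0P.
apply: le_lambda_min => // [|u]; first exact: principal_submx_sym.
pose x j := if j \in J then u (enum_rank_in j0J j) else 0.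
have x0 j : j \notin J -> x j = 0 by rewrite /x => /negPf ->.
have xu : (fun i : 'I_#|J| => x (enum_val i)) = u.
  by apply/funext => i; rewrite /x enum_valP enum_valK_in.
rewrite -xu -(sqn_enum_val x0) -(qform_enum_val _ x0).
have -> : qform A x = qform K x.
  apply: eq_bigr => j _; apply: eq_bigr => k _.
  have [jJ|/x0 ->] := boolP (j \in J); last by rewrite mul0r !mulr0.
  have [kJ|/x0 ->] := boolP (k \in J); last by rewrite !mulr0.
  by rewrite KA.
by apply: lambda_min_lb => //; exact: leq_ltn_trans (leq0n _) (ltn_ord j0).
Qed.

Lemma lambda_min_le_diag A j : A^T = A -> lambda_min A <= A j j.
Proof.
move=> As; have n0 := leq_ltn_trans (leq0n j) (ltn_ord j).
have := lambda_min_lb (fun k => (k == j)%:R) n0 As.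
rewrite /qform (bform_delta _ _ As) /sqn (bigD1 j)//= eqxx expr1n.
rewrite big1 => [|k /negPf ->]; last by rewrite expr0n.
rewrite addr0 mulr1 (bigD1 j)//= eqxx mul1r big1 ?addr0// => k /negPf ->.
by rewrite mul0r.
Qed.

(** For nonnegative entries, passing to absolute values can only increase each term; this turns the
    entrywise bound R^(l) <= R into a bound on top eigenvalues. *)
Lemma qform_le_norm A A' x : (forall j k, 0 <= A j k <= A' j k) ->
  qform A x <= qform A' (fun j => `|x j|).
Proof.
move=> AA'; apply: ler_sum => j _; apply: ler_sum => k _.
have /andP[A0 AA] := AA' j k; apply: (@le_trans _ _ (A j k * `|x j * x k|)).
  exact: ler_wpM2l (ler_norm _).
by rewrite -normrM; exact: ler_wpM2r.
Qed.

Lemma sqn_norm x : sqn (fun j => `|x j|) = sqn x.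
Proof. by apply: eq_bigr => j _; rewrite real_normK ?num_real. Qed.

End PrincipalSubmatrix.

Lemma schur_sym (R : realType) n (A B : 'M[R]_n) :
  A^T = A -> B^T = B -> (schur A B)^T = schur A B.
Proof.
by move=> As Bs; apply/matrixP => j k; rewrite !mxE -[in LHS]As -[in LHS]Bs !mxE.
Qed.

Lemma Rmx_diag (R : realType) p (G : 'I_p -> {fset nat}) l j :
  (l <= #|` G j|)%N -> Rmx R G l j j = 1.
Proof.
move=> lj; have := Rmx_mul_sqrt (R := R) G l j j; rewrite fsetIid -expr2 sqr_sqrtr//.
move=> H; apply: (mulIf _ (etrans H (esym (mul1r _)))).
by rewrite pnatr_eq0 -lt0n bin_gt0.
Qed.

(** The absorption identity l C(m, l) = m C(m-1, l-1) is applied to all three binomials; the factors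
    [l] cancel. *)
Lemma Rmx_shift (R : realType) p (G : 'I_p -> {fset nat}) l j k :
  (0 < l)%N -> (l <= #|` G j|)%N -> (l <= #|` G k|)%N ->
  Rmx R G l j k = Rmx R G 1 j k * 'C(#|` G j `&` G k|%fset - 1, l - 1)%:R /
    (Num.sqrt 'C(#|` G j| - 1, l - 1)%:R * Num.sqrt 'C(#|` G k| - 1, l - 1)%:R).
Proof.
move=> l0 lj lk; set n := #|` _ |%fset; set a := #|` G j|; set b := #|` G k|.
have bin_shift m : (l * 'C(m, l))%N = (m * 'C(m - 1, l - 1))%N.
  case: l l0 {lj lk} => // l _; case: m => [|m]; first by rewrite bin0n muln0.
  by rewrite !subn1 /= -mul_bin_diag.
have sqrt_gt0 m r : (r <= m)%N -> Num.sqrt 'C(m, r)%:R != 0 :> R.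
  by move=> rm; rewrite gt_eqF// sqrtr_gt0 ltr0n bin_gt0.
have sqrt_shift m : (l <= m)%N -> Num.sqrt 'C(m - 1, l - 1)%:R =
    Num.sqrt l%:R * Num.sqrt 'C(m, l)%:R / Num.sqrt 'C(m, 1)%:R :> R.
  move=> lm; rewrite -sqrtrM ?ler0n// -natrM bin_shift natrM sqrtrM ?ler0n//.
  rewrite bin1 mulrAC mulfV ?mul1r// gt_eqF// sqrtr_gt0 ltr0n; exact: leq_trans l0 lm.
have ls : Num.sqrt l%:R * Num.sqrt l%:R = l%:R :> R by rewrite -expr2 sqr_sqrtr.
have lsn : Num.sqrt l%:R != 0 :> R by rewrite gt_eqF// sqrtr_gt0 ltr0n.
have n1 : n%:R * 'C(n - 1, l - 1)%:R = Num.sqrt l%:R * Num.sqrt l%:R * 'C(n, l)%:R :> R.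
  by rewrite ls -!natrM bin_shift.
rewrite (sqrt_shift a)// (sqrt_shift b)// !mxE -/n -/a -/b (bin1 n).
have H1 := sqrt_gt0 a l lj; have H2 := sqrt_gt0 b l lk.
have H3 := sqrt_gt0 a 1%N (leq_trans l0 lj).
have H4 := sqrt_gt0 b 1%N (leq_trans l0 lk).
rewrite -[RHS](_ : n%:R * 'C(n - 1, l - 1)%:R *
  (Num.sqrt 'C(a, 1)%:R)^-1 / Num.sqrt 'C(b, 1)%:R /
  (Num.sqrt l%:R * Num.sqrt 'C(a, l)%:R / Num.sqrt 'C(a, 1)%:R *
  (Num.sqrt l%:R * Num.sqrt 'C(b, l)%:R / Num.sqrt 'C(b, 1)%:R)) = _).
  by rewrite n1; field; rewrite H1 H2 H3 H4 lsn.
by congr (_ / _); ring.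
Qed.

Section ShiftedFamily.
Context {R : realType} (p : nat) (G G0 : 'I_p -> {fset nat}).
Hypothesis G0I : forall j k : 'I_p, (j < k)%N ->
  #|` G0 j `&` G0 k|%fset = (#|` G j `&` G k|%fset - 1)%N.
Hypothesis G0_le : forall j, (#|` G0 j| <= #|` G j| - 1)%N.

(* On [J^(l)], [R^(l)] is the Schur product of [R] with a matrix of unit diagonal
   whose off-diagonal entries are those of a Gram matrix with diagonal at most 1:
   the vector of [j] is the normalized indicator of the [(l-1)]-subsets of [G0 j]. *)
Lemma lambda_min_shift_lb (W : 'M[R]_p) l (x : 'I_p -> R) :
  (0 < p)%N -> W^T = W -> (forall j, 0 <= W j j) -> (0 < l)%N ->
  (forall j, (#|` G j| < l)%N -> x j = 0) ->
  lambda_min (schur (Rmx R G 1) W) * sqn x <= qform (schur (Rmx R G l) W) x.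
Proof.
move=> p0 Ws W0 l0 x0; set Q := schur (Rmx R G 1) W.
have Qs : Q^T = Q by apply: schur_sym => //; exact: Rmx_sym.
pose n := (\sum_j \sum_(i <- G0 j) i).+1.
(* The normalization comes from [Rmx_shift] and counts subsets of |G_j| - 1 points, at least as many
   as [G0 j] has; hence norms at most 1. *)
pose c j : R := Num.sqrt 'C(#|` G j| - 1, l - 1)%:R.
pose w (S : {set 'I_n}) j :=
  ((S \subset ord_fset n (G0 j)) && (#|S| == (l - 1)%N))%:R * (x j / c j).
have wE j k : \sum_S w S j * w S k =
    'C(#|` G0 j `&` G0 k|%fset, l - 1)%:R * (x j / c j * (x k / c k)).
  rewrite -(@sum_common_draws n) => [|i]; last exact: fset_family_bound.
  by apply: eq_bigr => S _; rewrite mulrACA.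
have x_neq0 j : x j != 0 -> (l <= #|` G j|)%N.
  by apply: contraNT; rewrite -ltnNge => /x0 ->.
have QE j k : schur (Rmx R G l) W j k * (x j * x k) =
    Q j k * (\sum_S w S j * w S k) +
    (j == k)%:R * (Q j k * (x j ^+ 2 - \sum_S w S j ^+ 2)).
  have [xj0|xj] := eqVneq (x j) 0.
    rewrite xj0 expr0n mul0r mulr0 [X in _ = Q j k * X + _]big1 => [|S _]; last first.
      by rewrite /w xj0 !(mul0r, mulr0).
    rewrite mulr0 add0r big1 ?subrr ?mulr0// => S _.
    by rewrite /w xj0 !(mul0r, mulr0) expr0n.
  have [xk0|xk] := eqVneq (x k) 0.
    have jk : (j == k) = false by apply: contraNF xj => /eqP ->; rewrite xk0.
    rewrite xk0 jk mul0r addr0 !mulr0 big1 ?mulr0// => S _.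
    by rewrite /w xk0 !(mul0r, mulr0).
  have [lj lk] := (x_neq0 _ xj, x_neq0 _ xk).
  have [<-|jk] := eqVneq j k.
    rewrite [schur _ _ j j]mxE [Q j j]mxE !Rmx_diag//; last exact: leq_trans l0 lj.
    have -> : \sum_S w S j * w S j = \sum_S w S j ^+ 2.
      by apply: eq_bigr => S _; rewrite expr2.
    by rewrite [true%:R * _]mul1r; ring.
  rewrite mul0r addr0 wE.
  have -> : #|` G0 j `&` G0 k|%fset = (#|` G j `&` G k|%fset - 1)%N.
    have [lt_jk|lt_kj|/val_inj E] := ltngtP j k; first exact: G0I.
      by rewrite fsetIC (fsetIC (G j)) G0I.
    by rewrite E eqxx in jk.
  rewrite [schur _ _ j k]mxE -mulrA.
  rewrite (Rmx_shift _ l0)// -/(c j) -/(c k) [Q j k]mxE invfM; ring.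
(* A Gram part, bounded for each [S] by the smallest eigenvalue of [Q], plus the diagonal defect,
   bounded because that eigenvalue is at most [Q j j] and the defect is nonnegative. The squared
   norm splits in the same way. *)
have -> : qform (schur (Rmx R G l) W) x =
    \sum_S qform Q (w S) + \sum_j Q j j * (x j ^+ 2 - \sum_S w S j ^+ 2).
  rewrite /qform /bform [X in _ = X + _]exchange_big -big_split.
  apply: eq_bigr => j _ /=.
  rewrite exchange_big; under eq_bigr do rewrite QE.
  rewrite big_split /=; congr (_ + _).
    by apply: eq_bigr => k _; rewrite mulr_sumr.
  rewrite (bigD1 j)//= eqxx mul1r [X in _ + X = _]big1 ?addr0// => k kj.
  by rewrite eq_sym (negPf kj) mul0r.
have -> : sqn x = \sum_S sqn (w S) + \sum_j (x j ^+ 2 - \sum_S w S j ^+ 2).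
  rewrite /sqn exchange_big -big_split; apply: eq_bigr => j _ /=.
  by rewrite addrC subrK.
rewrite mulrDr; apply: lerD; rewrite mulr_sumr; apply: ler_sum.
  by move=> S _; exact: lambda_min_lb.
move=> j _; apply: ler_wpM2r; last exact: lambda_min_le_diag.
have [xj0|/x_neq0 lj] := eqVneq (x j) 0.
  by rewrite big1 ?subr0 ?sqr_ge0// => S _; rewrite /w xj0 mul0r mulr0 expr0n.
under eq_bigr do rewrite expr2.
have cj : c j ^+ 2 = 'C(#|` G j| - 1, l - 1)%:R by rewrite sqr_sqrtr.
have c0 : 0 < c j ^+ 2 by rewrite cj ltr0n bin_gt0 leq_sub2r.
rewrite wE fsetIid -expr2 exprMn exprVn mulrCA subr_ge0 ler_piMr ?sqr_ge0//.
by rewrite ler_pdivrMr// mul1r cj ler_nat leq_bin2l.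
Qed.

End ShiftedFamily.

(** * Extreme symmetric correlations *)


Section ExtremeCorrelations.
Context d (T : measurableType d) (R : realType) (P : probability T R).
Variables (Y : nat -> {RV P >-> R}) (p : nat) (G : 'I_p -> {fset nat}).
Variable W : 'M[R]_p.
Hypotheses (p_gt0 : (0 < p)%N) (Y_iid : iid Y) (W_sym : W^T = W).

Lemma corr_weighted_sym f : (corr_weighted Y W f)^T = @corr_weighted _ _ _ _ _ Y G W f.
Proof.
apply/matrixP => j k; rewrite !mxE -[in LHS]W_sym mxE; congr (_ * _).
by rewrite /corr covarianceC mulrC (mulrC (Num.sqrt _)) mulrC.
Qed.

Lemma schur_Rmx_sym l : (schur (Rmx R G l) W)^T = schur (Rmx R G l) W.
Proof. by apply: schur_sym => //; exact: Rmx_sym. Qed.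

Lemma le_lambda_min_corr_weighted f lam : symm_class Y f ->
  (forall l (x : 'I_p -> R), (0 < l <= ell_star G)%N ->
     (forall j, (#|` G j| < l)%N -> x j = 0) ->
     lam * sqn x <= qform (schur (Rmx R G l) W) x) ->
  lam <= lambda_min (@corr_weighted _ _ _ _ _ Y G W f).
Proof.
move=> fS lamP; apply: le_lambda_min => //; first exact: corr_weighted_sym.
by move=> u; exact: corr_weighted_lb.
Qed.

(** The lower bound [corr_weighted_lb] is applied to [- W] with the constant [- c]. *)
Lemma lambda_max_corr_weighted_le f : symm_class Y f ->
  (forall j k, 0 <= W j k) ->
  lambda_max (@corr_weighted _ _ _ _ _ Y G W f) <= lambda_max (schur (Rmx R G 1) W).
Proof.
move=> fS W0; set c := lambda_max (schur _ _).
apply: lambda_max_le => //; first exact: corr_weighted_sym.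
move=> u; have : - c * sqn u <= qform (corr_weighted Y (- W) f) u.
  apply: corr_weighted_lb => //; first by rewrite linearN /= W_sym.
  move=> l x /andP[l0 _] _.
  have -> : schur (Rmx R G l) (- W) = - schur (Rmx R G l) W.
    by apply/matrixP => j k; rewrite !mxE mulrN.
  rewrite qformN mulNr lerN2 -(sqn_norm x).
  apply: le_trans (lambda_max_ub (fun j => `|x j|) p_gt0 (schur_Rmx_sym 1)).
  apply: qform_le_norm => j k; rewrite [schur _ _ j k]mxE [X in _ <= _ <= X]mxE.
  by rewrite mulr_ge0 ?Rmx_ge0 ?W0//= ler_wpM2r// Rmx_le.
have -> : corr_weighted Y (- W) f = - corr_weighted Y W f.
  by apply/matrixP => j k; rewrite !mxE mulrN.
by rewrite qformN mulNr lerN2.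
Qed.

Hypothesis Y_nondeg : nondegenerate_rv (Y 0%N).

Lemma ustat_corr_weighted (deg : 'I_p -> nat) :
  (forall j, (0 < deg j <= #|` G j|)%N) ->
  exists2 f, symm_class Y f & forall j k, deg j = deg k ->
    @corr_weighted _ _ _ _ _ Y G W f j k = schur (Rmx R G (deg j)) W j k.
Proof.
move=> degP; have [h [mh [M hM] h0 h2]] := nondegenerate_kernel Y_nondeg.
have deg0 j : (0 < deg j)%N by have /andP[] := degP j.
have degG j : (deg j <= #|` G j|)%N by have /andP[] := degP j.
exists (fun j => @ustat R h (deg j) #|` G j|).
  exact: (ustat_symm_class Y_iid mh hM h0 h2 deg0 degG).
move=> j k djk; rewrite !mxE; congr (_ * _).
by rewrite (ustat_corr Y_iid mh hM h0 h2 G deg0 djk) mxE.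
Qed.

End ExtremeCorrelations.

(* Y 0 is the generic copy Y; the sample Y_1, Y_2, ... is (Y i) for i > 0. *)
Theorem theorem3 (d : measure_display) (T : measurableType d) (R : realType)
    (P : probability T R) (Y : nat -> {RV P >-> R}) (p : nat)
    (G : 'I_p -> {fset nat}) (W : 'M[R]_p)
    (p_gt0 : (0 < p)%N)
    (Y_iid : iid Y)
    (Y_nondeg : nondegenerate_rv (Y 0%N))
    (G_pos : forall (j : 'I_p) (i : nat), i \in G j -> (0 < i)%N)
    (G_neq0 : forall j : 'I_p, G j != fset0)
    (W_sym : W^T = W)
    (W_ge0 : forall j k : 'I_p, 0 <= W j k) :
  [/\ rho_max_symm Y G W = (lambda_max (schur (Rmx R G 1) W))%:E,
      rho_min_symm Y G W =
        \big[Order.min/+oo%E]_(1 <= l < (ell_star G).+1)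
          (lambda_min (principal_submx (schur (Rmx R G l) W) (Jset G l)))%:E &
      (exists G0 : 'I_p -> {fset nat},
         [/\ forall (j : 'I_p) (i : nat), i \in G0 j -> (0 < i)%N,
             forall j k : 'I_p, (j < k)%N ->
               #|` G0 j `&` G0 k|%fset = (#|` G j `&` G k|%fset - 1)%N &
             forall j : 'I_p, (#|` G0 j| <= #|` G j| - 1)%N]) ->
      rho_min_symm Y G W = (lambda_min (schur (Rmx R G 1) W))%:E].
Proof.
have G1 j : (0 < #|` G j|)%N by rewrite cardfs_gt0.
have R_sym l := schur_Rmx_sym G W_sym l.
(* Degree 1 throughout realizes R o W itself, which attains both the supremum and, for a shifted
   family, the infimum. *)
have [f1 f1S f1E] : exists2 f, @symm_class _ _ _ _ _ Y G f &
    corr_weighted Y W f = schur (Rmx R G 1) W.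
  have [f fS fE] := ustat_corr_weighted W Y_iid Y_nondeg (deg := fun=> 1%N) (G := G) G1.
  by exists f => //; apply/matrixP => j k; rewrite fE.
split.
- apply/eqP; rewrite eq_le; apply/andP; split.
    apply: ge_ereal_sup => _ [f fS <-]; rewrite lee_fin.
    exact: lambda_max_corr_weighted_le.
  by apply: ereal_sup_ubound; exists f1 => //; rewrite f1E.
- have J_gt0 l : (0 < l <= ell_star G)%N -> (0 < #|Jset G l|)%N.
    (* The index of a largest set belongs to every J^(l), so no principal submatrix is empty. *)
    move=> /andP[_ lG]; pose j0 := [arg max_(j > Ordinal p_gt0) #|` G j|].
    apply/card_gt0P; exists j0; rewrite inE; apply: leq_trans lG _.
    by apply/bigmax_leqP => j _; rewrite /j0; case: arg_maxnP => // i _; exact.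
  apply/eqP; rewrite eq_le; apply/andP; split.
    rewrite big_nat_cond; apply: le_bigmin; first exact: leey.
    move=> l; rewrite andbT ltnS => lG.
    (* Outside J^(l) a non-degenerate function is still required; degree 1 is available since [G j]
       is nonempty. *)
    pose deg j := if (l <= #|` G j|)%N then l else 1%N.
    have degP j : (0 < deg j <= #|` G j|)%N.
      rewrite /deg; case: (leqP l #|` G j|) => [lj|_]; last by rewrite G1.
      by case/andP: lG => ->.
    have [f fS fE] := ustat_corr_weighted W Y_iid Y_nondeg degP.
    apply: ge_ereal_inf; exists (lambda_min (corr_weighted Y W f))%:E.
      by exists f.
    rewrite lee_fin; apply: lambda_min_le_principal => //; first exact: J_gt0.
      exact: corr_weighted_sym.
    move=> j k; rewrite !inE => lj lk.
    by rewrite fE /deg lj// lk.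
  apply: le_ereal_inf_tmp => _ [f fS <-].
  pose g l := lambda_min (principal_submx (schur (Rmx R G l) W) (Jset G l)).
  (* A single real constant has to serve all orders at once, so the minimum over [l] is first
     located at some [l0]; ordinals start at 0, hence the shift by one. *)
  have [l0 l0P l0min] : exists2 l0, (0 < l0 <= ell_star G)%N &
      forall l, (0 < l <= ell_star G)%N -> g l0 <= g l.
    have L0 : (0 < ell_star G)%N.
      by apply: leq_trans (G1 (Ordinal p_gt0)) _; exact: (leq_bigmax (Ordinal p_gt0)).
    case: (arg_minP (fun i : 'I_(ell_star G) => g i.+1)
      (isT : xpredT (Ordinal L0))) => i _ imin.
    exists i.+1 => [|l /andP[l0 lL]]; first by rewrite ltn_ord.
    have lp : (l.-1 < ell_star G)%N by rewrite prednK.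
    by have := imin (Ordinal lp) isT; rewrite /= prednK.
  apply: (@le_trans _ _ (g l0)%:E).
    by apply: ge_bigmin_seq => //; rewrite mem_index_iota ltnS.
  rewrite lee_fin; apply: le_lambda_min_corr_weighted => // l x lG x0.
  apply: le_trans (lambda_min_principal_lb (J := Jset G l) (J_gt0 _ lG) (R_sym l) _).
    by rewrite ler_wpM2r ?sqn_ge0// l0min.
  by move=> j; rewrite inE -ltnNge => /x0.
- move=> [G0 [_ G0I G0_le]]; apply/eqP; rewrite eq_le; apply/andP; split.
    by apply: ereal_inf_lbound; exists f1 => //; rewrite f1E.
  apply: le_ereal_inf_tmp => _ [f fS <-]; rewrite lee_fin.
  apply: le_lambda_min_corr_weighted => // l x /andP[l0 _] x0.
  exact: (lambda_min_shift_lb G0I G0_le).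
Qed.
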